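(* Let $\mathbb{A}\oplus\mathbb{B}$ be a 1-truncated conformal algebra, $\mathcal{C}=C(\mathbb{A}\oplus\mathbb{B})/\hat\partial C(\mathbb{A})$, and let $S(\mathcal{C})=\coprod_{n\in\mathbb{N}}S(\mathcal{C})_{(n)}$ be the symmetric algebra with its vertex Poisson structure $Y_-$, derivation $\mathcal{D}$, and grading induced from that of $\mathcal{C}$. Then $(S(\mathcal{C}),\mathcal{D})$ is an $\mathbb{N}$-graded vertex Poisson algebra. In particular, $S(\mathcal{C})_{(0)}=S(\mathbb{A})$, the symmetric algebra over $\mathbb{A}$, and for $n\ge1$, $$S(\mathcal{C})_{(n)}=\mathrm{span}_{\mathbb{C}}\{\mathcal{D}^{n_1}(b_1)\cdots\mathcal{D}^{n_k}(b_k)\cdot a_1\cdots a_l\ :\ a_j\in\mathbb{A},\ b_i\in\mathbb{B},\ l\in\mathbb{N},\ k\ge1,\ n_1\ge\dots\ge n_k\ge0,\ n_1+\dots+n_k+k=n\}.$$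
   Context: All vector spaces are over $\mathbb{C}$ and $\mathbb{N}=\{0,1,2,\dots\}$. $\mathrm{Der}$ denotes the space of derivations of an algebra. For a formal series $f(x_1,\dots,x_n)=\sum_{m_i\in\mathbb{Z}}u(m_1,\dots,m_n)x_1^{-m_1-1}\cdots x_n^{-m_n-1}$, $\mathrm{Sing}\,f$ denotes the part of the sum with all $m_i\in\mathbb{N}$. Powers $(x_1-x_2)^{-k}$ are expanded in nonnegative powers of $x_2$. A vertex Lie algebra is a vector space $A$ with a linear operator $\partial$ and a linear map $Y_-:A\to\mathrm{Hom}(A,x^{-1}A[x^{-1}])$, $a\mapsto Y_-(a,x)=\sum_{n\in\mathbb{N}}a_nx^{-n-1}$ ($a_n\in\mathrm{End}\,A$), such that for $a,b\in A$: $a_nb=0$ for $n$ sufficiently large; $Y_-(\partial a,x)=\frac{d}{dx}Y_-(a,x)$; $Y_-(a,x)b=\mathrm{Sing}(e^{x\partial}Y_-(b,-x)a)$; $[Y_-(a,x_1),Y_-(b,x_2)]=\mathrm{Sing}(Y_-(Y_-(a,x_1-x_2)b,x_2))$. A differential algebra is a commutative associative algebra with identity $1$ together with a derivation $\partial$. A vertex Poisson algebra is a differential algebra $(A,\partial)$ with a vertex Lie algebra structure $(Y_-,\partial)$ (same $\partial$) such that $a_n(bc)=(a_nb)c+b(a_nc)$ for $a,b,c\in A$, $n\in\mathbb{N}$. It is $\mathbb{N}$-graded if $A=\coprod_{n\in\mathbb{N}}A_{(n)}$ is a grading of $A$ as an algebra and $\partial A_{(r)}\subset A_{(r+1)}$,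 $a_mA_{(r)}\subset A_{(r+n-m-1)}$ for $a\in A_{(n)}$, $m,n,r\in\mathbb{N}$ (where $A_{(k)}=0$ for $k<0$). A 1-truncated conformal algebra is a graded vector space $C_0\oplus C_1$ with a linear map $\partial:C_0\to C_1$ and bilinear operations $(u,v)\mapsto u_iv$ ($i=0,1$) of degree $-i-1$ on $C_0\oplus C_1$ (so results in degrees other than $0,1$ vanish) such that: for $a\in C_0$, $u\in C_1$: $(\partial a)_0=0$, $(\partial a)_1=-a_0$, $\partial(u_0a)=u_0\partial a$; for $a\in C_0$, $u,v\in C_1$: $u_0a=-a_0u$, $u_0v=-v_0u+\partial(v_1u)$, $u_1v=v_1u$; for all $\alpha,\beta,\gamma\in C_0\oplus C_1$ and $i=0,1$: $\alpha_0\beta_i\gamma=\beta_i\alpha_0\gamma+(\alpha_0\beta)_i\gamma$. Construction of $\mathcal{C}$. Let $\mathbb{A}\oplus\mathbb{B}$ be a 1-truncated conformal algebra with $C_0=\mathbb{A}$, $C_1=\mathbb{B}$. Put $C(\mathbb{A}\oplus\mathbb{B})=\mathbb{C}[\mathcal{D}]\otimes(\mathbb{A}\oplus\mathbb{B})$ with $\mathcal{D}$ a formal variable, $C(\mathbb{A})=\mathbb{C}[\mathcal{D}]\otimes\mathbb{A}$, identify $u\in\mathbb{A}\oplus\mathbb{B}$ with $1\otimes u$, let $\mathcal{D}(\mathcal{D}^n\otimes u)=\mathcal{D}^{n+1}\otimes u$, and let $\hat\partial=1\otimes\partial-\mathcal{D}\otimes1:C(\mathbb{A})\to C(\mathbb{A}\oplus\mathbb{B})$,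 i.e. $\hat\partial(\mathcal{D}^n\otimes a)=\mathcal{D}^n\otimes\partial a-\mathcal{D}^{n+1}\otimes a$. Grade $C(\mathbb{A}\oplus\mathbb{B})$ by $\deg(\mathcal{D}^n\otimes a)=n$ for $a\in\mathbb{A}$ and $\deg(\mathcal{D}^n\otimes b)=n+1$ for $b\in\mathbb{B}$; $\hat\partial$ is homogeneous of degree 1. Define the linear map $Y^0_-:C(\mathbb{A}\oplus\mathbb{B})\to\mathrm{Hom}(C(\mathbb{A}\oplus\mathbb{B}),x^{-1}C(\mathbb{A}\oplus\mathbb{B})[x^{-1}])$, $Y^0_-(u,x)=\sum_{n\in\mathbb{N}}u_nx^{-n-1}$, by: for $a,a'\in\mathbb{A}$, $b,b'\in\mathbb{B}$, $u,v\in\mathbb{A}\oplus\mathbb{B}$, $n\ge1$, $m\in\mathbb{N}$, $Y^0_-(a,x)a'=0$; $Y^0_-(a,x)b=a_0b\,x^{-1}$; $Y^0_-(b,x)a=b_0a\,x^{-1}$; $Y^0_-(b,x)b'=b_0b'x^{-1}+b_1b'x^{-2}$; $Y^0_-(u,x)e^{x_1\mathcal{D}}v=e^{x_1\mathcal{D}}e^{-x_1\frac{d}{dx}}Y^0_-(u,x)v$ (with $x_1$ a formal variable); $Y^0_-(\mathcal{D}^n\otimes u,x)(\mathcal{D}^m\otimes v)=\mathrm{Sing}\big(e^{x\mathcal{D}}(-\tfrac{d}{dx})^mY^0_-(v,-x)(\mathcal{D}^n\otimes u)\big)$. The subspace $\hat\partial C(\mathbb{A})$ is graded, $\mathcal{D}$-stable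 and a two-sided ideal for all the products $u_nv$, so $\mathcal{D}$, $Y^0_-$ and the grading descend to $\mathcal{C}=C(\mathbb{A}\oplus\mathbb{B})/\hat\partial C(\mathbb{A})$. The image of $\mathcal{D}^n\otimes u$ in $\mathcal{C}$ is written $\mathcal{D}^nu$. $S(\mathcal{C})$ is the symmetric algebra over $\mathcal{C}$, with $\mathcal{D}$ extended to a derivation and the grading induced from $\mathcal{C}$. Its vertex Poisson structure $Y_-$ is as follows: for $u\in\mathcal{C}$, $\widetilde{Y^0_-}(u,x)\in x^{-1}(\mathrm{Der}\,S(\mathcal{C}))[[x^{-1}]]$ is the unique element with $\widetilde{Y^0_-}(u,x)v=Y^0_-(u,x)v$ for $v\in\mathcal{C}$; for $a\in S(\mathcal{C})$, $Y_-(a,x)\in x^{-1}(\mathrm{Der}\,S(\mathcal{C}))[[x^{-1}]]$ is determined by $Y_-(a,x)u=\mathrm{Sing}(e^{x\mathcal{D}}\widetilde{Y^0_-}(u,-x)a)$ for $u\in\mathcal{C}$. One has $Y_-(u,x)=\widetilde{Y^0_-}(u,x)$ for $u\in\mathcal{C}$. *)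

(* Defs.v *)
From HB Require Import structures.
From mathcomp Require Import all_boot all_order all_algebra.
From mathcomp Require Import boolp classical_sets functions fsbigop.
From mathcomp Require Import reals complex.

Set Implicit Arguments.
Unset Strict Implicit.
Unset Printing Implicit Defensive.

Import GRing.Theory.
Local Open Scope ring_scope.
Local Open Scope quotient_scope.
Local Open Scope classical_set_scope.

(* A formal series in x^-1 V[[x^-1]] is represented by its sequence of
   coefficients: [f : nat -> V] stands for \sum_n (f n) x^(-n-1). *)

Section Series.
Variables (K : fieldType) (V : lmodType K).
Implicit Types (f : nat -> V) (D : V -> V).

(* d/dx x^(-n-1) = - (n+1) x^(-n-2) *)
Definition ser_deriv f : nat -> V :=
  fun n => if n is n'.+1 then - (n'.+1%:R *: f n') else 0.

(* f(-x), with (-x)^(-n-1) = (-1)^(n+1) x^(-n-1) *)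
Definition ser_neg f : nat -> V := fun n => (-1) ^+ n.+1 *: f n.

(* Sing (e^(xD) f(x)); the sum has finite support when f is a polynomial in
   x^-1, which is the only case where it is used. *)
Definition sing_exp D f : nat -> V :=
  fun n => \sum_(j \in [set: nat]) (j`!%:R)^-1 *: iter j D (f (n + j)%N).

End Series.

(* [Y a b n] is a_n b, so that [Y a b] is the series Y_-(a,x)b. *)

Section VertexPoisson.
Variable K : fieldType.

Record vertex_lie (A : lmodType K) (d : A -> A) (Y : A -> A -> nat -> A) : Prop :=
  VertexLie {
    vl_dlin : linear d;
    vl_linl : forall b n, linear (fun a => Y a b n);
    vl_linr : forall a n, linear (fun b => Y a b n);
    vl_trunc : forall a b, exists N, forall n, (N <= n)%N -> Y a b n = 0;
    vl_deriv : forall a b, Y (d a) b = ser_deriv (Y a b);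
    vl_skew : forall a b, Y a b = sing_exp d (ser_neg (Y b a));
    (* Coefficient of x1^(-m-1) x2^(-n-1) in
       [Y_-(a,x1), Y_-(b,x2)] c = Sing (Y_-(Y_-(a,x1-x2)b, x2) c), using
       (x1-x2)^(-i-1) = \sum_k 'C(i+k,i) x1^(-i-1-k) x2^k; only k = m - i
       contributes. *)
    vl_comm : forall a b c m n,
      Y a (Y b c n) m - Y b (Y a c m) n =
      \sum_(i < m.+1) 'C(m, i)%:R *: Y (Y a b i) c (m - i + n)%N
  }.

Definition derivation (A : comAlgType K) (d : A -> A) : Prop :=
  linear d /\ forall a b, d (a * b) = d a * b + a * d b.

Record vertex_poisson (A : comAlgType K) (d : A -> A) (Y : A -> A -> nat -> A)
  : Prop := VertexPoisson {
    vp_der : derivation d;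
    vp_lie : vertex_lie d Y;
    vp_leibniz : forall a b c n, Y a (b * c) n = Y a b n * c + b * Y a c n
  }.

Record algebra_grading (A : comAlgType K) (gr : nat -> set A) : Prop :=
  AlgebraGrading {
    ag_zero : forall n, gr n 0;
    ag_lin : forall n (c : K) a b, gr n a -> gr n b -> gr n (c *: a + b);
    ag_sum : forall a, exists N, exists2 c : nat -> A,
      (forall n, gr n (c n)) & a = \sum_(n < N) c n;
    ag_direct : forall N (c : nat -> A), (forall n, gr n (c n)) ->
      \sum_(n < N) c n = 0 -> forall n, (n < N)%N -> c n = 0;
    ag_one : gr 0%N 1;
    ag_mul : forall m n a b, gr m a -> gr n b -> gr (m + n)%N (a * b)
  }.

Record graded_vertex_poisson (A : comAlgType K) (d : A -> A)
    (Y : A -> A -> nat -> A) (gr : nat -> set A) : Prop :=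
  GradedVertexPoisson {
    gvp_vp : vertex_poisson d Y;
    gvp_gr : algebra_grading gr;
    gvp_d : forall r a, gr r a -> gr r.+1 (d a);
    gvp_Y : forall n r m a b, gr n a -> gr r b ->
      if (m < n + r)%N then gr (n + r - m.+1)%N (Y a b m) else Y a b m = 0
  }.

End VertexPoisson.

(* C_0 + C_1 is the product [A * B]. *)

Section TruncatedConformal.
Variables (K : fieldType) (A B : lmodType K).

Definition tc_deg (k : int) : set (A * B) :=
  if k == 0 then [set w | w.2 = 0]
  else if k == 1 then [set w | w.1 = 0]
  else [set 0].

Definition in0 (a : A) : A * B := (a, 0).
Definition in1 (b : B) : A * B := (0, b).

Local Notation "0'" := (@ord0 1).
Local Notation "1'" := (@ord_max 1).

Record truncated_conformal (d : {linear A -> B})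
    (op : 'I_2 -> A * B -> A * B -> A * B) : Prop := TruncatedConformal {
  tc_linl : forall i v, linear (fun u => op i u v);
  tc_linr : forall i u, linear (op i u);
  tc_homog : forall (i : 'I_2) (p q : int) u v,
    tc_deg p u -> tc_deg q v -> tc_deg (p + q - (i : nat)%:Z - 1) (op i u v);
  tc_d0 : forall a w, op 0' (in1 (d a)) w = 0;
  tc_d1 : forall a w, op 1' (in1 (d a)) w = - op 0' (in0 a) w;
  tc_dop : forall a u,
    in1 (d (op 0' (in1 u) (in0 a)).1) = op 0' (in1 u) (in1 (d a));
  tc_skew01 : forall a u, op 0' (in1 u) (in0 a) = - op 0' (in0 a) (in1 u);
  tc_skew0 : forall u v, op 0' (in1 u) (in1 v) =
    - op 0' (in1 v) (in1 u) + in1 (d (op 1' (in1 v) (in1 u)).1);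
  tc_skew1 : forall u v, op 1' (in1 u) (in1 v) = op 1' (in1 v) (in1 u);
  tc_jacobi : forall i x y z,
    op 0' x (op i y z) = op i y (op 0' x z) + op i (op 0' x y) z
}.

End TruncatedConformal.

Arguments in0 {K A B} a.
Arguments in1 {K A B} b.

(* An element is a finitely supported sequence [f], standing for
   \sum_n D^n (x) (f n). *)

Section PolyMod.
Variables (K : fieldType) (V : lmodType K).

Definition fin_seq : {pred nat -> V} :=
  [pred f | `[< exists N, forall n, (N <= n)%N -> f n = 0 >]].

Lemma fin_seq_submod : submod_closed fin_seq.
Proof.
split=> [|c f g]; first by apply/asboolP; exists 0%N.
move=> /asboolP[M fM] /asboolP[N gN]; apply/asboolP.
exists (maxn M N) => n; rewrite geq_max => /andP[Mn Nn].
have -> : (c *: f + g) n = c *: f n + g n by [].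
by rewrite fM // gN // scaler0 addr0.
Qed.

HB.instance Definition _ :=
  GRing.isSubmodClosed.Build K (nat -> V) fin_seq fin_seq_submod.

Record polymod := PolyMod { pm_val :> nat -> V; pm_fin : pm_val \in fin_seq }.

HB.instance Definition _ := [isSub for pm_val].
HB.instance Definition _ := [Choice of polymod by <:].
HB.instance Definition _ := [SubChoice_isSubLmodule of polymod by <:].

Definition mono_val n (v : V) : nat -> V := fun m => if m == n then v else 0.

Lemma mono_fin n v : mono_val n v \in fin_seq.
Proof.
apply/asboolP; exists n.+1 => m nm.
by rewrite /mono_val; case: eqP nm => // ->; rewrite ltnn.
Qed.

(* D^n (x) v *)
Definition mono n (v : V) : polymod := PolyMod (mono_fin n v).

Definition shift_val (f : polymod) : nat -> V :=
  fun n => if n is n'.+1 then f n' else 0.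

Lemma shift_fin f : shift_val f \in fin_seq.
Proof.
case/asboolP: (pm_fin f) => N fN; apply/asboolP; exists N.+1 => -[//|n] /=.
exact: fN.
Qed.

(* the operator D *)
Definition shift (f : polymod) : polymod := PolyMod (shift_fin f).

End PolyMod.

Lemma polymap_fin (K : fieldType) (V W : lmodType K) (h : {linear V -> W})
  (f : polymod V) : (h \o f) \in @fin_seq K W.
Proof.
case/asboolP: (pm_fin f) => N fN; apply/asboolP; exists N => n Nn /=.
by rewrite fN ?linear0.
Qed.

(* 1 (x) h *)
Definition polymap (K : fieldType) (V W : lmodType K) (h : {linear V -> W})
  (f : polymod V) : polymod W := PolyMod (polymap_fin h f).

Section Coker.
Variables (K : fieldType) (W V : lmodType K) (h : {linear W -> V}).

Definition lin_im : {pred V} := [pred v | `[< exists w, h w = v >]].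

Lemma lin_im_submod : submod_closed lin_im.
Proof.
split=> [|c u v]; first by apply/asboolP; exists 0; rewrite linear0.
move=> /asboolP[u' <-] /asboolP[v' <-]; apply/asboolP.
by exists (c *: u' + v'); rewrite linearP.
Qed.

HB.instance Definition _ :=
  GRing.isSubmodClosed.Build K V lin_im lin_im_submod.

(* V / h(W) *)
Definition coker : Type := Quotient.quot lin_im.

HB.instance Definition _ := GRing.Zmodule.on coker.
HB.instance Definition _ := EqQuotient.on coker.

Definition qproj (v : V) : coker := \pi_coker v.

Lemma qproj_eq u v : (qproj u == qproj v) = (u - v \in lin_im).
Proof. by rewrite Quotient.idealrBE. Qed.

Lemma qproj_repr (x : coker) : qproj (repr x) = x.
Proof. exact: reprK. Qed.

Lemma qproj_is_additive : zmod_morphism qproj.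
Proof. by move=> u v; rewrite /qproj; exact: (raddfB \pi_(Quotient.quot lin_im)). Qed.

Definition qscale (c : K) (x : coker) : coker := qproj (c *: repr x).

Lemma qscaleE c v : qscale c (qproj v) = qproj (c *: v).
Proof.
apply/eqP; rewrite qproj_eq -scalerBr rpredZ //.
by rewrite -qproj_eq qproj_repr.
Qed.

Lemma qprojD u v : qproj (u + v) = qproj u + qproj v.
Proof. exact: (raddfD \pi_(Quotient.quot lin_im)). Qed.

Lemma qscaleA a b x : qscale a (qscale b x) = qscale (a * b) x.
Proof. by rewrite -[x]qproj_repr !qscaleE scalerA. Qed.
Lemma qscale1 : left_id 1 qscale.
Proof. by move=> x; rewrite -[x]qproj_repr qscaleE scale1r. Qed.
Lemma qscaleDr : right_distributive qscale +%R.
Proof.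
move=> c x y; rewrite -[x]qproj_repr -[y]qproj_repr.
by rewrite -qprojD !qscaleE scalerDr qprojD.
Qed.
Lemma qscaleDl x : {morph qscale^~ x : a b / a + b}.
Proof. by move=> a b; rewrite -[x]qproj_repr !qscaleE scalerDl qprojD. Qed.

HB.instance Definition _ :=
  GRing.Zmodule_isLmodule.Build K coker qscaleA qscale1 qscaleDr qscaleDl.

Lemma qproj_is_linear : linear qproj.
Proof. by move=> c u v; rewrite qprojD -qscaleE. Qed.

HB.instance Definition _ :=
  GRing.isLinear.Build K V coker _ qproj qproj_is_linear.

End Coker.

(* S(V) is the commutative K-algebra presented by the generators [SVar v],
   v in V, and the relations making [SVar] linear: formal expressions modulo
   the congruence generated by the axioms of commutative algebras and by these
   relations. Its universal property is [symalg_univ] below. *)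

Section SymAlg.
Variables (K : fieldType) (V : lmodType K).

Inductive symterm : Type :=
  | SVar of V
  | SCst of K
  | SAdd of symterm & symterm
  | SMul of symterm & symterm.

HB.instance Definition _ := gen_eqMixin symterm.
HB.instance Definition _ := gen_choiceMixin symterm.

Inductive symeq : symterm -> symterm -> Prop :=
  | symeq_refl x : symeq x x
  | symeq_sym x y : symeq x y -> symeq y x
  | symeq_trans x y z : symeq x y -> symeq y z -> symeq x z
  | symeq_add x x' y y' : symeq x x' -> symeq y y' ->
      symeq (SAdd x y) (SAdd x' y')
  | symeq_mul x x' y y' : symeq x x' -> symeq y y' ->
      symeq (SMul x y) (SMul x' y')
  | symeq_addA x y z : symeq (SAdd x (SAdd y z)) (SAdd (SAdd x y) z)
  | symeq_addC x y : symeq (SAdd x y) (SAdd y x)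
  | symeq_add0 x : symeq (SAdd (SCst 0) x) x
  | symeq_addN x : symeq (SAdd (SMul (SCst (-1)) x) x) (SCst 0)
  | symeq_mulA x y z : symeq (SMul x (SMul y z)) (SMul (SMul x y) z)
  | symeq_mulC x y : symeq (SMul x y) (SMul y x)
  | symeq_mul1 x : symeq (SMul (SCst 1) x) x
  | symeq_mulD x y z :
      symeq (SMul (SAdd x y) z) (SAdd (SMul x z) (SMul y z))
  | symeq_cstD a b : symeq (SCst (a + b)) (SAdd (SCst a) (SCst b))
  | symeq_cstM a b : symeq (SCst (a * b)) (SMul (SCst a) (SCst b))
  | symeq_lin c u v :
      symeq (SVar (c *: u + v)) (SAdd (SMul (SCst c) (SVar u)) (SVar v)).

Definition symeqb (x y : symterm) : bool := `[< symeq x y >].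

Lemma symeqb_equiv : equiv_class_of symeqb.
Proof.
split=> [x|x y|y x z].
- by apply/asboolP; exact: symeq_refl.
- by apply/asboolP/asboolP; exact: symeq_sym.
- move=> /asboolP xy /asboolP yz; apply/asboolP; exact: symeq_trans xy yz.
Qed.

Canonical symeq_rel := EquivRelPack symeqb_equiv.
Canonical symeq_encModRel := defaultEncModRel symeqb.

Definition symalg : Type := {eq_quot symeqb}.

HB.instance Definition _ := Choice.on symalg.
HB.instance Definition _ := EqQuotient.on symalg.

Definition sproj (t : symterm) : symalg := \pi_symalg t.

Lemma sproj_repr (x : symalg) : sproj (repr x) = x.
Proof. exact: reprK. Qed.

Lemma sprojP s t : sproj s = sproj t <-> symeq s t.
Proof.
have -> : (sproj s = sproj t) = is_true (sproj s == sproj t).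
  by apply/propext; split=> /eqP.
by rewrite /sproj piE; split=> /asboolP.
Qed.

Lemma repr_sproj t : symeq (repr (sproj t)) t.
Proof. by apply/sprojP; rewrite sproj_repr. Qed.

Definition sadd (x y : symalg) : symalg := sproj (SAdd (repr x) (repr y)).
Definition smul (x y : symalg) : symalg := sproj (SMul (repr x) (repr y)).
Definition sopp (x : symalg) : symalg := smul (sproj (SCst (-1))) x.
Definition sscale (c : K) (x : symalg) : symalg := smul (sproj (SCst c)) x.

Lemma saddE s t : sadd (sproj s) (sproj t) = sproj (SAdd s t).
Proof. by apply/sprojP/symeq_add; exact: repr_sproj. Qed.
Lemma smulE s t : smul (sproj s) (sproj t) = sproj (SMul s t).
Proof. by apply/sprojP/symeq_mul; exact: repr_sproj. Qed.

Lemma saddA : associative sadd.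
Proof.
move=> x y z; rewrite -[x]sproj_repr -[y]sproj_repr -[z]sproj_repr !saddE.
exact/sprojP/symeq_addA.
Qed.
Lemma saddC : commutative sadd.
Proof.
move=> x y; rewrite -[x]sproj_repr -[y]sproj_repr !saddE.
exact/sprojP/symeq_addC.
Qed.
Lemma sadd0 : left_id (sproj (SCst 0)) sadd.
Proof.
by move=> x; rewrite -[x]sproj_repr saddE; exact/sprojP/symeq_add0.
Qed.
Lemma saddN : left_inverse (sproj (SCst 0)) sopp sadd.
Proof.
move=> x; rewrite -[x]sproj_repr /sopp smulE saddE.
exact/sprojP/symeq_addN.
Qed.

HB.instance Definition _ :=
  GRing.isZmodule.Build symalg saddA saddC sadd0 saddN.

Lemma sprojD s t : sproj (SAdd s t) = sproj s + sproj t.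
Proof. by rewrite -saddE. Qed.

Lemma smulA : associative smul.
Proof.
move=> x y z; rewrite -[x]sproj_repr -[y]sproj_repr -[z]sproj_repr !smulE.
exact/sprojP/symeq_mulA.
Qed.
Lemma smulC : commutative smul.
Proof.
move=> x y; rewrite -[x]sproj_repr -[y]sproj_repr !smulE.
exact/sprojP/symeq_mulC.
Qed.
Lemma smul1 : left_id (sproj (SCst 1)) smul.
Proof.
by move=> x; rewrite -[x]sproj_repr smulE; exact/sprojP/symeq_mul1.
Qed.
Lemma smulDl : left_distributive smul +%R.
Proof.
move=> x y z; rewrite -[x]sproj_repr -[y]sproj_repr -[z]sproj_repr.
rewrite -sprojD !smulE -sprojD.
exact/sprojP/symeq_mulD.
Qed.

Fixpoint symeval (T : comAlgType K) (f : V -> T) (t : symterm) : T :=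
  match t with
  | SVar v => f v
  | SCst c => c%:A
  | SAdd x y => symeval f x + symeval f y
  | SMul x y => symeval f x * symeval f y
  end.

Lemma symeval_eq (T : comAlgType K) (f : {linear V -> T}) s t :
  symeq s t -> symeval f s = symeval f t.
Proof.
elim=> {s t} /=.
- by [].
- by [].
- by move=> x y z _ -> _ ->.
- by move=> x x' y y' _ -> _ ->.
- by move=> x x' y y' _ -> _ ->.
- by move=> x y z; rewrite addrA.
- by move=> x y; rewrite addrC.
- by move=> x; rewrite scale0r add0r.
- by move=> x; rewrite scaleN1r mulN1r scale0r addNr.
- by move=> x y z; rewrite mulrA.
- by move=> x y; rewrite mulrC.
- by move=> x; rewrite scale1r mul1r.
- by move=> x y z; rewrite mulrDl.
- by move=> a b; rewrite scalerDl.
- by move=> a b; rewrite mulr_algl scalerA.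
- by move=> c u v; rewrite linearP mulr_algl.
Qed.

Lemma sone_neq0 : sproj (SCst 1) != 0.
Proof.
apply/eqP => /sprojP /(@symeval_eq K^o (\0 : V -> K^o)) /= /eqP.
by rewrite scale1r scale0r oner_eq0.
Qed.

HB.instance Definition _ := GRing.Zmodule_isComNzRing.Build symalg
  smulA smulC smul1 smulDl sone_neq0.

Lemma sprojM s t : sproj (SMul s t) = sproj s * sproj t.
Proof. by rewrite -smulE. Qed.

Lemma sscaleA a b x : sscale a (sscale b x) = sscale (a * b) x.
Proof.
rewrite /sscale smulA smulE; congr smul.
exact/sprojP/symeq_sym/symeq_cstM.
Qed.
Lemma sscale1 : left_id 1 sscale.
Proof. by move=> x; rewrite /sscale smul1. Qed.
Lemma sscaleDr : right_distributive sscale +%R.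
Proof. by move=> c x y; exact: (@mulrDr symalg). Qed.
Lemma sscaleDl x : {morph sscale^~ x : a b / a + b}.
Proof.
move=> a b; rewrite -[RHS]smulDl -sprojD; congr smul.
exact/sprojP/symeq_cstD.
Qed.

HB.instance Definition _ :=
  GRing.Zmodule_isLmodule.Build K symalg sscaleA sscale1 sscaleDr sscaleDl.

Lemma sscaleAl (c : K) (x y : symalg) : c *: (x * y) = (c *: x) * y.
Proof. exact: smulA. Qed.

HB.instance Definition _ := GRing.Lmodule_isLalgebra.Build K symalg sscaleAl.
HB.instance Definition _ := GRing.Lalgebra_isComAlgebra.Build K symalg.

(* the canonical map V -> S(V) *)
Definition symin (v : V) : symalg := sproj (SVar v).

Lemma symin_is_linear : linear symin.
Proof.
move=> c u v; rewrite /symin (_ : c *: _ = sproj (SMul (SCst c) (SVar u))).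
  by rewrite -sprojD; exact/sprojP/symeq_lin.
by rewrite -smulE.
Qed.

HB.instance Definition _ :=
  GRing.isLinear.Build K V symalg _ symin symin_is_linear.

Lemma sproj_cst c : sproj (SCst c) = c%:A.
Proof. by rewrite -[LHS]mulr1. Qed.

Lemma symalg_ind (Q : symalg -> Prop) :
  (forall v, Q (symin v)) -> (forall c : K, Q c%:A) ->
  (forall x y, Q x -> Q y -> Q (x + y)) ->
  (forall x y, Q x -> Q y -> Q (x * y)) -> forall x, Q x.
Proof.
move=> Qv Qc QD QM x; rewrite -[x]sproj_repr.
elim: (repr x) => [v|c|s Qs t Qt|s Qs t Qt].
- exact: Qv.
- by rewrite sproj_cst.
- by rewrite sprojD; exact: QD.
- by rewrite sprojM; exact: QM.
Qed.

Section Lift.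
Variables (T : comAlgType K) (f : {linear V -> T}).

Definition symlift (x : symalg) : T := symeval f (repr x).

Lemma symlift_sproj t : symlift (sproj t) = symeval f t.
Proof. exact/symeval_eq/repr_sproj. Qed.

Lemma symlift_cst (c : K) : symlift c%:A = c%:A.
Proof. by rewrite -sproj_cst symlift_sproj. Qed.

Lemma symlift_add x y : symlift (x + y) = symlift x + symlift y.
Proof.
by rewrite -[x]sproj_repr -[y]sproj_repr -sprojD !symlift_sproj.
Qed.

Lemma symlift_mul x y : symlift (x * y) = symlift x * symlift y.
Proof.
by rewrite -[x]sproj_repr -[y]sproj_repr -sprojM !symlift_sproj.
Qed.

Lemma symlift_scale (c : K) x : symlift (c *: x) = c *: symlift x.
Proof. by rewrite -mulr_algl symlift_mul symlift_cst mulr_algl. Qed.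

Lemma symlift_monoid : monoid_morphism symlift.
Proof.
split; last exact: symlift_mul.
by rewrite -(scale1r 1) symlift_cst scale1r.
Qed.

Lemma symlift_linear : linear symlift.
Proof. by move=> c x y; rewrite symlift_add symlift_scale. Qed.

HB.instance Definition _ :=
  GRing.isLinear.Build K symalg T _ symlift symlift_linear.
HB.instance Definition _ :=
  GRing.isMonoidMorphism.Build symalg T symlift symlift_monoid.

Lemma symlift_symin v : symlift (symin v) = f v.
Proof. by rewrite symlift_sproj. Qed.

Lemma symalg_univ : exists2 g : {lrmorphism symalg -> T},
  (forall v, g (symin v) = f v) &
  forall g' : {lrmorphism symalg -> T},
    (forall v, g' (symin v) = f v) -> g' =1 g.
Proof.
exists symlift => [v|g' g'f]; first exact: symlift_symin.
apply: symalg_ind => [v|c|x y|x y].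
- by rewrite g'f /= symlift_symin.
- by rewrite linearZ rmorph1 /= symlift_cst.
- by rewrite !rmorphD /= => -> ->.
- by rewrite !rmorphM /= => -> ->.
Qed.

End Lift.
End SymAlg.

Definition lin_span (K : fieldType) (V : lmodType K) (P : set V) : set V :=
  [set x | exists2 s : seq (K * V),
     {in s, forall t, P t.2} & x = \sum_(t <- s) t.1 *: t.2].

Definition sym_grading (K : fieldType) (V : lmodType K) (gr : nat -> set V)
    (n : nat) : set (symalg V) :=
  lin_span [set x | exists s : seq (nat * V),
    [/\ {in s, forall p, gr p.1 p.2},
        (\sum_(p <- s) p.1)%N = n &
        x = \prod_(p <- s) symin p.2]].

(* The unique derivation of S(V) that restricts to f on V. It exists when f is
   linear; the default value 0 is irrelevant. *)
Definition der_extend (K : fieldType) (V : lmodType K) (f : V -> symalg V) :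
    symalg V -> symalg V :=
  xget 0 [set delta | derivation delta /\ forall v, delta (symin v) = f v].

Section Construction.
Variables (K : fieldType) (A B : lmodType K).
Variables (d : {linear A -> B}) (op : 'I_2 -> A * B -> A * B -> A * B).

Local Notation AB := (A * B)%type.
Local Notation CAB := (polymod AB).

Lemma in0_is_linear : linear (@in0 K A B).
Proof. by move=> c a a'; congr pair; rewrite /= scaler0 addr0. Qed.
Lemma in1_is_linear : linear (@in1 K A B).
Proof. by move=> c b b'; congr pair; rewrite /= scaler0 addr0. Qed.

HB.instance Definition _ :=
  GRing.isLinear.Build K A AB _ (@in0 K A B) in0_is_linear.
HB.instance Definition _ :=
  GRing.isLinear.Build K B AB _ (@in1 K A B) in1_is_linear.

(* D^n (x) a |-> D^n (x) da - D^(n+1) (x) a *)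
Definition dhat (f : polymod A) : CAB :=
  polymap (@in1 K A B \o d) f - shift (polymap (@in0 K A B) f).

Lemma dhat_is_linear : linear dhat.
Proof.
move=> c f g; apply/val_inj/funext => n.
have valE h m : val (dhat h) m =
    in1 (d (h m)) - (if m is m'.+1 then in0 (h m') else 0) by [].
have cfgE m : (c *: f + g) m = c *: f m + g m by [].
have -> : val (c *: dhat f + dhat g) n =
    c *: val (dhat f) n + val (dhat g) n by [].
rewrite !valE cfgE !linearP scalerBr addrACA -opprD.
by case: n => [|n]; rewrite ?scaler0 ?addr0 // cfgE linearP.
Qed.

HB.instance Definition _ :=
  GRing.isLinear.Build K (polymod A) CAB _ dhat dhat_is_linear.

(* Y^0_-(u,x)v for u, v in A + B. By homogeneity of [op], this is the
   four-case definition: a_n a' = 0, and a_1 b = b_1 a = 0. *)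
Definition Y0_base (u v : AB) : nat -> CAB := fun n =>
  match n with
  | 0 => mono 0 (op ord0 u v)
  | 1 => mono 0 (op ord_max u v)
  | _ => 0
  end.

Definition ser_negderiv (f : nat -> CAB) : nat -> CAB := fun n => - ser_deriv f n.

(* Y^0_-(u,x) D^m v: this is m! times the coefficient of x1^m in
   e^(x1 D) e^(-x1 d/dx) Y^0_-(u,x) v. *)
Definition Y0_left (u : AB) (m : nat) (v : AB) : nat -> CAB := fun n =>
  \sum_(j < m.+1) 'C(m, j)%:R *:
    iter j (@shift K AB) (iter (m - j) ser_negderiv (Y0_base u v) n).

(* Y^0_-(D^n u, x) D^m v *)
Definition Y0_mono (n : nat) (u : AB) (m : nat) (v : AB) : nat -> CAB :=
  if n is 0 then Y0_left u m v
  else sing_exp (@shift K AB)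
         (iter m ser_negderiv (ser_neg (Y0_left v n u))).

Definition Y0 (f g : CAB) : nat -> CAB := fun k =>
  \sum_(n \in [set: nat]) \sum_(m \in [set: nat]) Y0_mono n (f n) m (g m) k.

Definition conf_alg : Type := coker dhat.
HB.instance Definition _ := GRing.Lmodule.on conf_alg.
HB.instance Definition _ := EqQuotient.on conf_alg.

(* the class of D^n (x) u *)
Definition conf_mono (n : nat) (u : AB) : conf_alg := qproj dhat (mono n u).

(* D and Y^0_- are evaluated on representatives, dhat(C(A)) being a D-stable
   two-sided ideal. *)
Definition conf_der (x : conf_alg) : conf_alg := qproj dhat (shift (repr x)).

Definition conf_Y (x y : conf_alg) : nat -> conf_alg := fun n =>
  qproj dhat (Y0 (repr x) (repr y) n).

Definition poly_grading (n : nat) : set CAB :=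
  [set f | forall m, (m != n -> (f m).1 = 0) /\ (m.+1 != n -> (f m).2 = 0)].

Definition conf_grading (n : nat) : set conf_alg :=
  [set qproj dhat f | f in poly_grading n].

Local Notation SC := (symalg conf_alg).

Definition sconf_der (a : SC) : SC := der_extend (fun u => symin (conf_der u)) a.

Definition sconf_Y0 (u : conf_alg) (a : SC) : nat -> SC := fun n =>
  der_extend (fun v => symin (conf_Y u v n)) a.

(* Y_-(a,x) is the series of derivations with
   Y_-(a,x) u = Sing (e^(xD) Y^0_-(u,-x) a) for u in C. *)
Definition sconf_Y (a b : SC) : nat -> SC := fun n =>
  der_extend (fun u => sing_exp sconf_der (ser_neg (sconf_Y0 u a)) n) b.

Definition sconf_grading : nat -> set SC := sym_grading conf_grading.

End Construction.

Arguments conf_Y {K A B} d op x y.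
Arguments sconf_Y0 {K A B} d op u a.
Arguments sconf_Y {K A B} d op a b.
Arguments sconf_der {K A B} d a.
Arguments conf_mono {K A B} d n u.
Arguments conf_grading {K A B} d n.
Arguments sconf_grading {K A B} d n.

(* Main.v *)
Require Import Defs.
From HB Require Import structures.
From mathcomp Require Import all_boot all_order all_algebra.
From mathcomp Require Import boolp classical_sets functions fsbigop.
From mathcomp Require Import reals complex.
From mathcomp Require Import ring.

(* Modulo the image of [dhat], the product [Y0 (D^n u) (D^m v)] is obtained from
   [Y0 u v] by applying [d/dx] [n] times and [D - d/dx] [m] times. Hence C is a
   vertex Lie algebra as soon as skew symmetry and the Jacobi identity hold on
   A + B, where they are the axioms of a 1-truncated conformal algebra.

   On S(C), [Y a] is a series of derivations by definition. Skew symmetry follows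
   by induction on one argument, from the Leibniz rule in the other one:
   [Y(bc, x) = (exp(x D) b) Y(c, x) + (exp(x D) c) Y(b, x)]. Granted skew symmetry,
   the Jacobi identity J(a, b, c) is invariant under permutations of a, b, c, and
   it is a derivation in c; it therefore propagates from C to S(C), one argument
   at a time.

   The grading is the eigenspace decomposition of the Euler derivation, which acts
   on generators of degree n as multiplication by n. That products are graded
   amounts to a commutation rule between this derivation, [D] and [Y], which is
   again checked on generators. *)

Set Implicit Arguments.
Unset Strict Implicit.
Unset Printing Implicit Defensive.

Import GRing.Theory.
Local Open Scope ring_scope.
Local Open Scope classical_set_scope.

(** * Polar parts of formal series *)

(** The formal calculus is reduced to the operator [ser_skew f] = Sing (e^(x D) f(-x)), under which
    skew symmetry reads [Y a b = ser_skew D (Y b a)]. It is an involution that exchanges d/dx with D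
    - d/dx. In characteristic 0 the finite series are generated by the v x^-1 under d/dx, so an
    identity between such operators is checked on v x^-1 and carried through derivatives; this
    avoids double sums of binomial coefficients. The treatment of C is shaped by the asymmetry of
    [Y0]: it is given directly for n = 0 and through the transposed product for n > 0. The two
    prescriptions are reconciled only modulo [dhat], because the axiom for u_0 v contains
    [d (v_1 u)] where skew symmetry requires D (v_1 u). Products are therefore first studied with
    arguments in C(A + B) and values in C. The grading of S(C) is defined by spans, from which
    neither directness nor the vanishing of products of negative degree can be read off. Eigenvalues
    give both: eigenvectors for distinct eigenvalues are independent, and no negative integer is an
    eigenvalue of the Euler derivation. *)

Lemma fsbig_nat_bounded (V : nmodType) (F : nat -> V) N :
  (forall n, (N <= n)%N -> F n = 0) ->
  \sum_(n \in [set: nat]) F n = \sum_(n < N) F n.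
Proof.
move=> F0; rewrite (fsbig_ord _ N F); apply/esym/fsbig_widen => // n [_] /= nN.
by apply: F0; rewrite leqNgt; apply/negP.
Qed.

Section FiniteSequences.
Variables (K : fieldType) (V : lmodType K).
Implicit Types f g : nat -> V.

Definition finite_seq f := exists N, forall n, (N <= n)%N -> f n = 0.

Lemma serD f g n : (f + g) n = f n + g n. Proof. by []. Qed.
Lemma serN f n : (- f) n = - f n. Proof. by []. Qed.
Lemma serZ (c : K) f n : (c *: f) n = c *: f n. Proof. by []. Qed.
Definition serE := (serD, serN, serZ).

Lemma finite_seqD f g : finite_seq f -> finite_seq g -> finite_seq (f + g).
Proof.
move=> [M fM] [N gN]; exists (maxn M N) => n; rewrite geq_max => /andP[Mn Nn].
by rewrite serD fM // gN // addr0.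
Qed.

Lemma finite_seqZ c f : finite_seq f -> finite_seq (c *: f).
Proof. by move=> [M fM]; exists M => n /fM; rewrite serZ => ->; rewrite scaler0. Qed.

Lemma finite_seq_mono n v : finite_seq (mono_val n v).
Proof. by exists n.+1 => m nm; rewrite /mono_val gtn_eqF. Qed.

(* [Sing (x f(x))] *)
Definition ser_shift f : nat -> V := fun n => f n.+1.

Lemma finite_seq_shift f : finite_seq f -> finite_seq (ser_shift f).
Proof. by move=> [N fN]; exists N => n Nn; apply/fN/ltnW. Qed.

(** The factor n kills the meaningless value at [0.-1], so later computations need no case split on
    n. *)
Lemma ser_derivE f n : ser_deriv f n = - (n%:R *: f n.-1).
Proof. by case: n => [|n] //=; rewrite scale0r oppr0. Qed.

Lemma finite_seq_deriv f : finite_seq f -> finite_seq (ser_deriv f).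
Proof.
by move=> [N fN]; exists N.+1 => -[//|n] Nn; rewrite ser_derivE fN // scaler0 oppr0.
Qed.

Lemma ser_deriv_is_linear : linear (@ser_deriv K V).
Proof.
move=> c f g; apply/funext => n.
by rewrite !serE !ser_derivE !serE scalerDr opprD !scalerN !scalerA mulrC.
Qed.
HB.instance Definition _ :=
  GRing.isLinear.Build K (nat -> V) (nat -> V) _ (@ser_deriv K V)
    ser_deriv_is_linear.

Lemma ser_derivD f g : ser_deriv (f + g) = ser_deriv f + ser_deriv g.
Proof. exact: linearD. Qed.
Lemma ser_derivZ c f : ser_deriv (c *: f) = c *: ser_deriv f.
Proof. exact: linearZ. Qed.

Lemma ser_shiftD f g : ser_shift (f + g) = ser_shift f + ser_shift g.
Proof. by []. Qed.
Lemma ser_shiftZ c f : ser_shift (c *: f) = c *: ser_shift f.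
Proof. by []. Qed.
Lemma ser_shiftB f g : ser_shift (f - g) = ser_shift f - ser_shift g.
Proof. by []. Qed.

(** The product rule x f' = (x f)' - f; the constant term of x f(x), which [ser_shift] drops, has
    derivative zero. *)
Lemma ser_shift_deriv f : ser_shift (ser_deriv f) = ser_deriv (ser_shift f) - f.
Proof.
apply/funext => n; rewrite !serE /ser_shift !ser_derivE.
rewrite -natr1 scalerDl scale1r opprD; congr (- _ - _).
by case: n => [|n]; rewrite ?scale0r.
Qed.

(* Finite series are spanned by the derivatives of the [v x^-1], as
   [x^(-n-1)] is a multiple of the [n]-th derivative of [x^-1]. *)
Lemma finite_seq_ind (char0 : forall n, n.+1%:R != 0 :> K)
    (P : (nat -> V) -> Prop) :
  (forall f g, finite_seq f -> finite_seq g -> P f -> P g -> P (f + g)) ->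
  (forall v, P (mono_val 0 v)) ->
  (forall f, finite_seq f -> P f -> P (ser_deriv f)) ->
  forall f, finite_seq f -> P f.
Proof.
move=> PD P0 PS f [N].
have Pm n v : P (mono_val n v).
  elim: n v => // n IH v.
  have -> : mono_val n.+1 v = ser_deriv (mono_val n (- (n.+1%:R^-1 *: v))).
    apply/funext => -[|k]; rewrite ser_derivE /= ?scale0r ?oppr0 // /mono_val.
    rewrite eqSS; case: eqP => [->|_]; last by rewrite scaler0 oppr0.
    by rewrite scalerN opprK scalerA mulfV ?scale1r.
  by apply: PS; [exact: finite_seq_mono | exact: IH].
elim: N f => [|N IH] f fN.
  have -> : f = mono_val 0 0 by apply/funext=> n; rewrite fN // /mono_val if_same.
  exact: Pm.
pose g := fun n => if n == N then 0 else f n.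
have gN n : (N <= n)%N -> g n = 0.
  by rewrite leq_eqVlt /g eq_sym; case: eqP => //= _ /fN.
have -> : f = g + mono_val N (f N).
  apply/funext => n; rewrite serD /g /mono_val.
  by case: eqP => [->|]; rewrite ?add0r ?addr0.
by apply: PD (IH _ gN) (Pm _ _); [exists N | exact: finite_seq_mono].
Qed.

End FiniteSequences.

(** * Binomial transforms of families of series *)

Section BinomialTransform.
Variables (K : fieldType) (V : lmodType K).
Implicit Types (s : K) (g : nat -> nat -> V).

(* [\sum_i 'C(m, i) (s x)^(m - i) g_i(x)], up to nonnegative powers of x. *)
Fixpoint binom_ser s m g : nat -> V :=
  if m is m'.+1 then
    s *: ser_shift (binom_ser s m' g) + binom_ser s m' (fun i => g i.+1)
  else g 0%N.

(** Pascal's rule. The closed form is the right-hand side of [vl_comm]; the recursive one is what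
    inductions on m use. *)
Lemma binom_ser1E m g n :
  binom_ser 1 m g n = \sum_(i < m.+1) 'C(m, i)%:R *: g i (m - i + n)%N.
Proof.
elim: m g n => [|m IH] g n.
  by rewrite big_ord1 bin0 scale1r.
rewrite /= !serE scale1r /ser_shift.
rewrite !IH [RHS]big_ord_recl [X in X + _]big_ord_recl/= /bump/= !bin0 -addrA.
congr (_ + _); first by rewrite !subn0 addnS.
under [X in _ = X]eq_bigr => i _ do
  rewrite add1n binS natrD scalerDl subSS.
rewrite big_split/= [X in _ = X + _]big_ord_recr/= bin_small // scale0r addr0.
congr (_ + _); apply: eq_bigr => i _.
by rewrite add1n addnS -addSn subnSK.
Qed.

Lemma finite_seq_binom s m g :
  (forall i, finite_seq (g i)) -> finite_seq (binom_ser s m g).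
Proof.
elim: m g => [|m IH] g fg //=.
by apply: finite_seqD; [apply/finite_seqZ/finite_seq_shift|]; exact: IH.
Qed.

Lemma binom_serD s m g h :
  binom_ser s m (fun i => g i + h i) = binom_ser s m g + binom_ser s m h.
Proof.
elim: m g h => //= m IH g h; rewrite !IH ser_shiftD.
by rewrite scalerDr addrACA.
Qed.

Lemma binom_serZ s m c g :
  binom_ser s m (fun i => c *: g i) = c *: binom_ser s m g.
Proof.
by elim: m g => //= m IH g; rewrite !IH ser_shiftZ scalerDr !scalerA mulrC.
Qed.

Lemma binom_ser_shift s m g :
  binom_ser s m (fun i => ser_shift (g i)) = ser_shift (binom_ser s m g).
Proof. by elim: m g => //= m IH g; rewrite !IH ser_shiftD ser_shiftZ. Qed.

(** Binomial inversion: on the generating function \sum_i g_i t^i / i!, the transform [binom_ser s]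
    is multiplication by e^(s x t). *)
Lemma binom_serK m g : binom_ser (-1) m (fun i => binom_ser 1 i g) = g m.
Proof.
elim: m g => //= m IH g.
rewrite -[RHS](IH (fun i => g i.+1)) IH binom_serD.
under [X in _ + (binom_ser _ _ X + _)]eq_fun do rewrite scale1r.
suff -> : binom_ser (-1) m (fun i => ser_shift (binom_ser 1 i g)) = ser_shift (g m).
  by rewrite scaleN1r addKr.
by rewrite binom_ser_shift IH.
Qed.

(** The product rule for d/dx of e^(s x t) \sum_i g_i t^i / i!. Its extra factor s t becomes s m
    together with a shift of the index m. *)
Lemma binom_ser_deriv s m g :
  binom_ser s m (fun i => ser_deriv (g i)) =
  ser_deriv (binom_ser s m g) - (s * m%:R) *: binom_ser s m.-1 g.
Proof.
elim: m g => [|m IH] g; first by rewrite mulr0 scale0r subr0.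
rewrite /= !IH ser_derivD ser_derivZ ser_shiftB ser_shiftZ ser_shift_deriv !scalerBr.
have -> : s *: ((s * m%:R) *: ser_shift (binom_ser s m.-1 g)) =
    (s * m%:R) *: binom_ser s m g -
      (s * m%:R) *: binom_ser s m.-1 (fun i => g i.+1).
  case: m {IH} => [|m]; first by rewrite mulr0 !scale0r scaler0 subr0.
  by rewrite /= scalerDr addrK !scalerA mulrC.
rewrite -[m.+1%:R]natr1 mulrDr mulr1 scalerDl opprB opprD -addrA.
by rewrite [X in _ + X = _]addrC subrKA addrACA [X in _ + X = _]addrC.
Qed.

(** The family i g_(i-1) comes from multiplying the generating function by t, which commutes with
    e^(s x t). *)
Lemma binom_ser_index s m g :
  binom_ser s m (fun i => i%:R *: g i.-1) = m%:R *: binom_ser s m.-1 g.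
Proof.
elim: m g => [|m IH] g; first by rewrite /= !scale0r.
rewrite /= IH.
under [X in _ + binom_ser _ _ X]eq_fun do
  rewrite -natr1 scalerDl scale1r.
rewrite binom_serD -[m.+1%:R]natr1 scalerDl scale1r addrA; congr (_ + _).
have -> : (fun i => i%:R *: g i) = (fun i => i%:R *: g i.-1.+1).
  by apply/funext => -[|i]//; rewrite !scale0r.
rewrite (IH (fun i => g i.+1)).
case: m {IH} => [|m]/=; first by rewrite !scale0r scaler0 addr0.
by rewrite ser_shiftZ !scalerDr !scalerA [_ * s]mulrC.
Qed.

End BinomialTransform.

(** * The skew-symmetry involution *)

Section Skew.
Variables (K : fieldType) (V : lmodType K) (D : {linear V -> V}).
Hypothesis char0 : forall n, n.+1%:R != 0 :> K.
Implicit Types f g : nat -> V.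

Definition divpow j (v : V) : V := (j`!%:R)^-1 *: iter j D v.

Lemma divpow_is_linear j : linear (divpow j).
Proof.
move=> c u v; rewrite /divpow scalerA mulrC -scalerA -scalerDr; congr (_ *: _).
by elim: j => //= j ->; rewrite linearP.
Qed.
HB.instance Definition _ j :=
  GRing.isLinear.Build K V V _ (divpow j) (divpow_is_linear j).

Lemma divpowZ j c v : divpow j (c *: v) = c *: divpow j v.
Proof. exact: linearZ. Qed.
Let DD u v : D (u + v) = D u + D v. Proof. exact: linearD. Qed.
Let DN v : D (- v) = - D v. Proof. exact: linearN. Qed.
Let DZ c v : D (c *: v) = c *: D v. Proof. exact: linearZ. Qed.

Lemma divpow0 v : divpow 0 v = v.
Proof. by rewrite /divpow fact0 invr1 scale1r. Qed.

Lemma divpowS j v : j.+1%:R *: divpow j.+1 v = D (divpow j v).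
Proof.
by rewrite /divpow [in RHS]linearZ/= scalerA factS natrM invfM mulrA mulfV ?mul1r.
Qed.

(* [Sing (exp(x D) f(-x))], so that skew symmetry reads
   [Y a b = ser_skew (Y b a)]. *)
Definition ser_skew f := sing_exp D (ser_neg f).

Lemma ser_skewE N f n : (forall j, (N <= j)%N -> f (n + j)%N = 0) ->
  ser_skew f n = \sum_(j < N) (-1) ^+ (n + j).+1 *: divpow j (f (n + j)%N).
Proof.
move=> f0; rewrite /ser_skew /sing_exp (@fsbig_nat_bounded _ _ N) => [|j Nj].
  by apply: eq_bigr => j _; rewrite -/(divpow _ _) divpowZ.
by rewrite -/(divpow _ _) /ser_neg f0 // scaler0 linear0.
Qed.

(** The bound does not depend on n and may be enlarged, so several skew transforms can be expanded
    over one range. *)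
Lemma ser_skewP f : finite_seq f -> exists N, forall M n, (N <= M)%N ->
  ser_skew f n = \sum_(j < M) (-1) ^+ (n + j).+1 *: divpow j (f (n + j)%N).
Proof.
move=> [N fN]; exists N => M n NM; apply: ser_skewE => j Mj.
by rewrite fN // (leq_trans NM) // (leq_trans Mj) // leq_addl.
Qed.

Lemma finite_seq_skew f : finite_seq f -> finite_seq (ser_skew f).
Proof.
move=> [N fN]; exists N => n Nn; rewrite (@ser_skewE 0) ?big_ord0 // => j _.
by rewrite fN // (leq_trans Nn) // leq_addr.
Qed.

Lemma ser_skewD f g : finite_seq f -> finite_seq g ->
  ser_skew (f + g) = ser_skew f + ser_skew g.
Proof.
move=> ff fg; apply/funext => n; rewrite serE.
have [M fM] := ser_skewP ff; have [N gN] := ser_skewP fg.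
have [P fgP] := ser_skewP (finite_seqD ff fg).
rewrite (fM (M + N + P)%N) ?(gN (M + N + P)%N) ?(fgP (M + N + P)%N).
- by rewrite -big_split; apply: eq_bigr => j _; rewrite serE linearD scalerDr.
- by rewrite leq_addl.
- by rewrite -addnA addnCA leq_addr.
- by rewrite -addnA leq_addr.
Qed.

Lemma ser_skewZ c f : finite_seq f -> ser_skew (c *: f) = c *: ser_skew f.
Proof.
move=> ff; apply/funext => n; rewrite serE.
have [M fM] := ser_skewP ff; have [N gN] := ser_skewP (finite_seqZ c ff).
rewrite (fM (M + N)%N) ?(gN (M + N)%N) ?leq_addr ?leq_addl //.
rewrite scaler_sumr; apply: eq_bigr => j _.
by rewrite serZ divpowZ scalerA mulrC -scalerA.
Qed.

Lemma ser_skewN f : finite_seq f -> ser_skew (- f) = - ser_skew f.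
Proof. by move=> ff; rewrite -scaleN1r ser_skewZ // scaleN1r. Qed.

Lemma ser_skewB f g : finite_seq f -> finite_seq g ->
  ser_skew (f - g) = ser_skew f - ser_skew g.
Proof.
by move=> ff fg; rewrite ser_skewD ?ser_skewN // -scaleN1r; exact: finite_seqZ.
Qed.

Lemma ser_skew_shift f : finite_seq f ->
  ser_skew (ser_shift f) = - ser_shift (ser_skew f).
Proof.
move=> ff; apply/funext => n; rewrite serE /ser_shift.
have [M fM] := ser_skewP ff; have [N gN] := ser_skewP (finite_seq_shift ff).
rewrite (fM (M + N)%N) ?(gN (M + N)%N) ?leq_addr ?leq_addl //.
rewrite -sumrN; apply: eq_bigr => j _.
by rewrite addSn [in RHS]exprS mulN1r scaleNr opprK.
Qed.

Lemma ser_skew_mono0 v : ser_skew (mono_val 0 v) = - mono_val 0 v.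
Proof.
apply/funext => n; rewrite serE (@ser_skewE 1) => [|[|j]//]; last first.
  by rewrite addnS.
rewrite big_ord1 addn0 divpow0 /mono_val.
by case: eqP => [->|]; rewrite ?scaleN1r // scaler0 oppr0.
Qed.

(* [D - d/dx], the effect on [Y(u, x) v] of applying [D] to [v]. *)
Definition ser_cov f : nat -> V := fun n => D (f n) - ser_deriv f n.

Lemma finite_seq_cov f : finite_seq f -> finite_seq (ser_cov f).
Proof.
move=> ff; have [M fM] := finite_seq_deriv ff; case: ff => N fN.
exists (maxn M N) => n; rewrite geq_max => /andP[Mn Nn].
by rewrite /ser_cov fM // fN // linear0 subr0.
Qed.

Lemma ser_covD f g : ser_cov (f + g) = ser_cov f + ser_cov g.
Proof.
by apply/funext => n; rewrite /ser_cov ser_derivD !serE DD opprD addrACA.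
Qed.

Lemma ser_covZ c f : ser_cov (c *: f) = c *: ser_cov f.
Proof.
by apply/funext => n; rewrite /ser_cov ser_derivZ !serE DZ scalerBr.
Qed.

Lemma ser_deriv_cov f : ser_deriv (ser_cov f) = ser_cov (ser_deriv f).
Proof.
apply/funext => n.
rewrite ser_derivE /ser_cov [ser_deriv f n]ser_derivE.
by rewrite [ser_deriv (ser_deriv f) n]ser_derivE DN DZ scalerBr opprB opprK addrC.
Qed.

(** This is d/dx (e^(x D) f(-x)) = D e^(x D) f(-x) - e^(x D) f'(-x). *)
Lemma ser_skew_deriv f : finite_seq f ->
  ser_skew (ser_deriv f) = ser_cov (ser_skew f).
Proof.
move=> ff; apply/funext => n.
have [M fM] := ser_skewP ff; have [N gN] := ser_skewP (finite_seq_deriv ff).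
rewrite /ser_cov ser_derivE opprK.
rewrite (fM (M + N)%N n) ?(fM (M + N).+1 n.-1) ?(gN (M + N).+1);
  rewrite ?leqW ?leq_addr ?leq_addl //.
set P := (M + N)%N.
(* The coefficient n + j of the derivative is split. The part j cancels against j! to produce D and
   loses its term j = 0, whence the range P + 1; the part n produces -d/dx. *)
transitivity (\sum_(j < P.+1) (-1) ^+ (n + j) *: divpow j (j%:R *: f (n + j).-1)
   + \sum_(j < P.+1) (-1) ^+ (n + j) *: divpow j (n%:R *: f (n + j).-1)).
  rewrite -big_split; apply: eq_bigr => j _/=.
  rewrite -scalerDr -linearD -scalerDl -natrD addnC ser_derivE linearN.
  by rewrite scalerN exprS mulN1r scaleNr opprK addnC.
congr (_ + _).
  rewrite big_ord_recl scale0r linear0 scaler0 add0r linear_sum; apply: eq_bigr.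
  by move=> j _; rewrite lift0 addnS DZ divpowZ divpowS.
case: n => [|n].
  by rewrite scale0r big1 // => j _; rewrite scale0r linear0 scaler0.
rewrite scaler_sumr; apply: eq_bigr => j _.
by rewrite addSn divpowZ scalerA mulrC -scalerA.
Qed.

(** The mirror image of [ser_skew_deriv]. Involutivity would give it at once, but [ser_skewK] is
    deduced from it; so it is checked on v x^-1 and propagated, [ser_cov] commuting with
    [ser_deriv]. *)
Lemma ser_skew_cov f : finite_seq f ->
  ser_skew (ser_cov f) = ser_deriv (ser_skew f).
Proof.
move: f; apply: (finite_seq_ind char0) => [f g ff fg Ef Eg|v|f ff Ef].
- rewrite ser_covD (ser_skewD (finite_seq_cov ff) (finite_seq_cov fg)).
  by rewrite (ser_skewD ff fg) ser_derivD Ef Eg.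
- have -> : ser_cov (mono_val 0 v) =
      mono_val 0 (D v) - ser_deriv (mono_val 0 v).
    by apply/funext => -[|n]; rewrite /ser_cov !serE //= linear0.
  have fm (w : V) := finite_seq_mono 0 w.
  rewrite (ser_skewB (fm _) (finite_seq_deriv (fm _))) ser_skew_mono0.
  rewrite (ser_skew_deriv (fm _)) ser_skew_mono0.
  rewrite -(scaleN1r (mono_val 0 v)) ser_derivZ ser_covZ !scaleN1r.
  apply/funext => n; rewrite !serE /ser_cov.
  rewrite opprB opprD opprK addrCA [mono_val 0 (D v) n](_ : _ = D (mono_val 0 v n)).
    by rewrite addNr addr0.
  by case: n => [|n] //=; rewrite /mono_val linear0.
- rewrite -ser_deriv_cov !ser_skew_deriv ?Ef ?ser_deriv_cov //.
  exact: finite_seq_cov.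
Qed.

Lemma ser_skewK f : finite_seq f -> ser_skew (ser_skew f) = f.
Proof.
move: f; apply: (finite_seq_ind char0) => [f g ff fg Ef Eg|v|f ff Ef].
- rewrite (ser_skewD ff fg).
  by rewrite (ser_skewD (finite_seq_skew ff) (finite_seq_skew fg)) Ef Eg.
- by rewrite ser_skew_mono0 (ser_skewN (finite_seq_mono 0 v)) ser_skew_mono0 opprK.
- by rewrite ser_skew_deriv // ser_skew_cov ?Ef //; exact: finite_seq_skew.
Qed.

End Skew.

Section LinearPredicate.
Variables (K : fieldType) (V W : lmodType K) (h : V -> W).
Hypothesis h_lin : linear h.

(** These rules serve maps such as [fun b => Y a b n], whose linearity is available as a proof of
    [linear] and not as a structure. *)
Lemma linear_predD u v : h (u + v) = h u + h v.
Proof. by rewrite -{1}[u]scale1r h_lin scale1r. Qed.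
Lemma linear_pred0 : h 0 = 0.
Proof. by apply: (addrI (h 0)); rewrite -linear_predD !addr0. Qed.
Lemma linear_predZ c v : h (c *: v) = c *: h v.
Proof. by rewrite -[c *: v]addr0 h_lin linear_pred0 addr0. Qed.
Lemma linear_predN v : h (- v) = - h v.
Proof. by rewrite -scaleN1r linear_predZ scaleN1r. Qed.
Lemma linear_predB u v : h (u - v) = h u - h v.
Proof. by rewrite linear_predD linear_predN. Qed.
Lemma linear_pred_sum I (r : seq I) (P : pred I) (F : I -> V) :
  h (\sum_(i <- r | P i) F i) = \sum_(i <- r | P i) h (F i).
Proof. exact: (big_morph h linear_predD linear_pred0). Qed.

End LinearPredicate.

(** Multiplied by x, the series v x^-1 loses its polar part; only the term i = m survives. *)
Lemma binom_ser_mono0 (K : fieldType) (V : lmodType K) (s : K) m (w : nat -> V) :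
  binom_ser s m (fun i => mono_val 0 (w i)) = mono_val 0 (w m).
Proof.
elim: m w => //= m IH w.
by rewrite !IH [ser_shift _](_ : _ = 0) ?scaler0 ?add0r.
Qed.

(** Here [mono_val 0 g] is a family of series, with [g] at index 0 and zero elsewhere; what remains
    is the polar part of x^m g(x). *)
Lemma binom_ser_single (K : fieldType) (V : lmodType K) (g : nat -> V) m n :
  binom_ser 1 m (mono_val 0 g) n = g (m + n)%N.
Proof.
elim: m n => //= m IH n; rewrite serD serZ scale1r /ser_shift IH addnS addSn.
rewrite [X in _ + X](_ : _ = 0) ?addr0 //.
by elim: m {IH} n => //= m IH n; rewrite serD serZ /ser_shift !IH scaler0 addr0.
Qed.

Section SkewTransform.
Variables (K : fieldType) (V : lmodType K) (D : {linear V -> V}).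
Hypothesis char0 : forall n, n.+1%:R != 0 :> K.

Lemma finite_seq_comp (h : V -> V) f :
  linear h -> finite_seq f -> finite_seq (fun n => h (f n)).
Proof. by move=> lh [N fN]; exists N => n /fN ->; exact: linear_pred0. Qed.

(* If [T i] is the [i]-th mode of a series [T(t)] with [[D, T(t)] = T'(t)], then
   [T(t) exp(x D) = exp(x D) T(t - x)] on nonnegative modes. *)
Lemma skew_apply (T : nat -> V -> V) (m : nat) (f : nat -> V) :
  (forall i, linear (T i)) ->
  (forall i v, T i (D v) = D (T i v) + i%:R *: T i.-1 v) ->
  finite_seq f ->
  (fun n => T m (ser_skew D f n)) =
  ser_skew D (binom_ser (-1) m (fun i n => T i (f n))).
Proof.
move=> Tlin TD.
have fT i g : finite_seq g -> finite_seq (fun n => T i (g n)).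
  exact: finite_seq_comp.
have fb i g : finite_seq g ->
    finite_seq (binom_ser (-1) i (fun i n => T i (g n))).
  by move=> fg; apply: finite_seq_binom => j; exact: fT.
move=> ff; move: f ff m.
apply: (finite_seq_ind char0) => [f g ff fg Ef Eg|v|f ff Ef] m.
- have -> : (fun i n => T i ((f + g) n)) =
      (fun i => (fun n => T i (f n)) + (fun n => T i (g n))).
    by apply/funext => i; apply/funext => n; rewrite !serE (linear_predD (Tlin i)).
  rewrite binom_serD (ser_skewD _ (fb m f ff) (fb m g fg)) -Ef -Eg.
  apply/funext => n; rewrite (ser_skewD _ ff fg) !serE.
  by rewrite (linear_predD (Tlin m)).
- have -> : (fun i n => T i (mono_val 0 v n)) = (fun i => mono_val 0 (T i v)).
    apply/funext => i; apply/funext => n; rewrite /mono_val.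
    by case: eqP => // _; exact: linear_pred0.
  rewrite binom_ser_mono0 !ser_skew_mono0; apply/funext => n.
  rewrite !serE (linear_predN (Tlin m)) /mono_val.
  by case: eqP => // _; rewrite (linear_pred0 (Tlin m)).
- have -> : (fun i n => T i (ser_deriv f n)) =
      (fun i => ser_deriv (fun n => T i (f n))).
    apply/funext => i; apply/funext => n; rewrite !ser_derivE.
    by rewrite (linear_predN (Tlin i)) (linear_predZ (Tlin i)).
  (* The correction in [binom_ser (-1) m.-1] matches the term m T_(m-1) of [TD]; the induction
     hypothesis is used at m and at m - 1. *)
  rewrite binom_ser_deriv mulN1r scaleNr opprK.
  rewrite ser_skewD; [|exact/finite_seq_deriv/fb|exact/finite_seqZ/fb].
  rewrite ser_skewZ; last exact: fb.
  rewrite !ser_skew_deriv //; last exact: fb.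
  rewrite -!Ef; apply/funext => n; rewrite serD serZ /ser_cov.
  rewrite (linear_predB (Tlin m)) TD !ser_derivE !opprK.
  by rewrite (linear_predN (Tlin m)) opprK (linear_predZ (Tlin m)) addrAC.
Qed.

(** Exchanging a and b on the right of the commutator formula exchanges the two variables and
    changes the sign, as the commutator on the left does. The induction on n trades a factor x for
    -x by [ser_skew_shift]; [zD] enters at n = 0. *)
Lemma binom_skew (z : V -> nat -> V) (f : nat -> V) (m n : nat) :
  (forall k, linear (z^~ k)) -> (forall v, z (D v) = ser_deriv (z v)) ->
  finite_seq f ->
  binom_ser 1 n (fun i => z (ser_skew D f i)) m =
  - binom_ser 1 m (fun i => z (f i)) n.
Proof.
move=> zlin zD ff; elim: n m f ff => [|n IH] m f ff.
- rewrite /=; move: f ff m.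
  apply: (finite_seq_ind char0) => [f g ff fg Ef Eg|v|f ff Ef] m.
  + rewrite (ser_skewD _ ff fg) serE (linear_predD (zlin m)) Ef Eg -opprD.
    rewrite -serD -binom_serD; congr (- binom_ser _ _ _ _).
    apply/funext => i; apply/funext => n.
    by rewrite !serE (linear_predD (zlin n)).
  + have -> : (fun i => z (mono_val 0 v i)) = mono_val 0 (z v).
      apply/funext => i; apply/funext => k; rewrite /mono_val.
      by case: eqP => // _; rewrite (linear_pred0 (zlin k)).
    by rewrite binom_ser_single ser_skew_mono0 serN (linear_predN (zlin m)) addn0.
  + rewrite ser_skew_deriv // /ser_cov /= subr0 zD ser_derivE; congr (- _).
    rewrite Ef.
    have -> : (fun i => z (ser_deriv f i)) = (fun i => - 1 *: (i%:R *: z (f i.-1))).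
      apply/funext => i; apply/funext => k; rewrite scaleN1r !serE ser_derivE.
      by rewrite (linear_predN (zlin k)) (linear_predZ (zlin k)).
    by rewrite binom_serZ (binom_ser_index 1 m (fun i => z (f i))) scaleN1r !serE scalerN.
- rewrite [LHS]/= serD serZ scale1r /ser_shift IH //.
  have -> : (fun i => z (ser_skew D f i.+1)) =
      (fun i => - 1 *: z (ser_skew D (ser_shift f) i)).
    apply/funext => i; apply/funext => k.
    rewrite ser_skew_shift // serZ serN (linear_predN (zlin k)).
    by rewrite scaleN1r opprK.
  rewrite binom_serZ serZ scaleN1r IH ?opprK; last exact: finite_seq_shift.
  by rewrite /= serD serZ scale1r /ser_shift opprD subrK.
Qed.

Lemma ser_skew_map (W : lmodType K) (D' : {linear W -> W}) (h : {linear V -> W}) f :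
  (forall v, h (D v) = D' (h v)) -> finite_seq f ->
  ser_skew D' (fun n => h (f n)) = fun n => h (ser_skew D f n).
Proof.
move=> hD.
have fh g : finite_seq g -> finite_seq (fun n => h (g n)).
  by move=> [N gN]; exists N => n /gN ->; rewrite linear0.
move: f; apply: (finite_seq_ind char0) => [f g ff fg Ef Eg|v|f ff Ef].
- have -> : (fun n => h ((f + g) n)) =
      (fun n => h (f n)) + (fun n => h (g n)) :> (nat -> W).
    by apply/funext => n; rewrite !serE linearD.
  rewrite (ser_skewD _ (fh f ff) (fh g fg)) Ef Eg.
  by rewrite (ser_skewD _ ff fg); apply/funext => n; rewrite !serE linearD.
- have h_mono w : (fun n => h (mono_val 0 w n)) = mono_val 0 (h w).
    by apply/funext => n; rewrite /mono_val; case: eqP => // _; rewrite linear0.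
  rewrite h_mono !ser_skew_mono0 -h_mono.
  by apply/funext => n; rewrite !serE linearN.
- have -> : (fun n => h (ser_deriv f n)) = ser_deriv (fun n => h (f n)) :> (nat -> W).
    by apply/funext => n; rewrite !ser_derivE linearN linearZ.
  rewrite (ser_skew_deriv _ char0 (fh f ff)) Ef ser_skew_deriv //.
  apply/funext => n; rewrite /ser_cov !ser_derivE !opprK.
  by rewrite linearD linearZ hD.
Qed.

End SkewTransform.

(** * Symmetries of the Jacobi identity *)

Section Jacobi.
Variables (K : fieldType) (V : lmodType K) (D : {linear V -> V}).
Variable Y : V -> V -> nat -> V.
Hypothesis char0 : forall n, n.+1%:R != 0 :> K.
Hypothesis Ylinl : forall b n, linear (fun a => Y a b n).
Hypothesis Ylinr : forall a n, linear (fun b => Y a b n).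
Hypothesis Yfin : forall a b, finite_seq (Y a b).
Hypothesis Yderiv : forall a b, Y (D a) b = ser_deriv (Y a b).
Hypothesis Yskew : forall a b, Y a b = ser_skew D (Y b a).

Definition jacobi a b c := forall m n, Y a (Y b c n) m - Y b (Y a c m) n =
  binom_ser 1 m (fun i => Y (Y a b i) c) n.

Lemma Y_cov a b : Y a (D b) = ser_cov D (Y a b).
Proof. by rewrite Yskew Yderiv ser_skew_deriv // -Yskew. Qed.

Lemma jacobi_swap_left a b c : jacobi a b c -> jacobi b a c.
Proof.
move=> J m n; rewrite -[LHS]opprB J (Yskew b a).
rewrite (binom_skew char0 (z := fun x => Y x c)) // => k; exact: Ylinl.
Qed.

(** Skew symmetry replaces Y_b c by Y_c b. Moving Y_a across e^(x D) costs a transform with s = -1,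
    and by [binom_serK] this undoes the transform on the right of J(a, c, b). *)
Lemma jacobi_swap_right a b c : jacobi a c b -> jacobi a b c.
Proof.
move=> J m n.
have YT i v : Y a (D v) i = D (Y a v i) + i%:R *: Y a v i.-1.
  by rewrite Y_cov /ser_cov ser_derivE opprK.
have -> : Y a (Y b c n) m =
    ser_skew D (binom_ser (-1) m (fun i n => Y a (Y c b n) i)) n.
  rewrite (Yskew b c); exact: (congr1 (@^~ n)
    (skew_apply char0 (T := fun i v => Y a v i) m (Ylinr a) YT (Yfin c b))).
have -> : (fun i n => Y a (Y c b n) i) =
    (fun i => Y c (Y a b i) + binom_ser 1 i (fun k => Y (Y a c k) b)).
  apply/funext => i; apply/funext => k.
  by rewrite serD -J addrC subrK.
rewrite binom_serD binom_serK ser_skewD //; last exact: finite_seq_binom.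
rewrite serD -Yskew addrK.
(* What is left is a transform with s = -1 inside [ser_skew]; each of its factors -x comes out as x,
   which restores s = 1. *)
elim: m n (Y a b) => [|m IH] n g /=; first by rewrite -Yskew.
have fb h : finite_seq (binom_ser (-1) m (fun i => Y c (h i))).
  exact: finite_seq_binom.
rewrite scaleN1r ser_skewD //; last first.
  by rewrite -scaleN1r; exact/finite_seqZ/finite_seq_shift.
rewrite ser_skewN ?ser_skew_shift ?opprK //; last exact: finite_seq_shift.
by rewrite !serD scale1r IH /ser_shift IH.
Qed.

Lemma jacobi_add a b c c' : jacobi a b c -> jacobi a b c' -> jacobi a b (c + c').
Proof.
move=> J J' m n.
have YD x k : Y x (c + c') k = Y x c k + Y x c' k.
  exact: (linear_predD (Ylinr x k)).
rewrite !YD (linear_predD (Ylinr a m)) (linear_predD (Ylinr b n)).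
rewrite opprD addrACA J J' -serD -binom_serD; congr (binom_ser _ _ _ _).
by apply/funext => i; apply/funext => k; rewrite YD.
Qed.

(** Replacing c by D c applies D - d/dx1 - d/dx2 to both sides. On C, which is generated by A + B
    under D, this takes the place that the Leibniz rule has on S(C). *)
Lemma jacobi_der a b c : jacobi a b c -> jacobi a b (D c).
Proof.
move=> J m n.
have YcE x y k : Y x (D y) k = D (Y x y k) + k%:R *: Y x y k.-1.
  by rewrite Y_cov /ser_cov ser_derivE opprK.
have -> : (fun i => Y (Y a b i) (D c)) = (fun i =>
    (fun k => D (Y (Y a b i) c k)) + - 1 *: ser_deriv (Y (Y a b i) c)).
  by apply/funext => i; apply/funext => k; rewrite Y_cov !serE scaleN1r.
rewrite binom_serD binom_serZ binom_ser_deriv mul1r scaleN1r opprB !serE.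
rewrite [binom_ser 1 m _ n](_ : _ =
    D (binom_ser 1 m (fun i => Y (Y a b i) c) n)); last first.
  rewrite !binom_ser1E linear_sum; apply: eq_bigr => i _; exact/esym/linearZ.
rewrite ser_derivE opprK -!J !YcE.
rewrite (linear_predD (Ylinr a m)) (linear_predD (Ylinr b n)).
rewrite (linear_predZ (Ylinr a m)) (linear_predZ (Ylinr b n)) !YcE.
rewrite !scalerBr [X in _ - X = _]addrAC !opprD addrACA [X in X + _ = _]addrACA.
by rewrite -[LHS]addrA; congr (_ + _); rewrite [RHS]linearB.
Qed.

(** How the third argument is extended from [G] is left as a hypothesis, since C is generated by D
    and sums, S(C) by products. The swaps bring each argument in turn into third position. *)
Lemma jacobi_generated (G : set V) :
  (forall a b, (forall c, G c -> jacobi a b c) -> forall c, jacobi a b c) ->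
  (forall a b c, G a -> G b -> G c -> jacobi a b c) ->
  forall a b c, jacobi a b c.
Proof.
move=> Gc J.
have J2 a c : G a -> G c -> forall b, jacobi a b c.
  by move=> Ga Gc' b; apply: jacobi_swap_right; apply: Gc => b' Gb'; exact: J.
have J1 a : G a -> forall b c, jacobi a b c.
  by move=> Ga b; apply: Gc => c Gc'; exact: J2.
move=> a b; apply: Gc => c Gc'.
by apply/jacobi_swap_right/jacobi_swap_left; exact: J1.
Qed.

End Jacobi.

(** * Derivations of symmetric algebras *)

Section Derivations.
Variables (K : fieldType) (A : comAlgType K).
Implicit Types (d e : A -> A).

Lemma derivation_lin d : derivation d -> linear d. Proof. by case. Qed.
Lemma derivationM d a b : derivation d -> d (a * b) = d a * b + a * d b.
Proof. by case=> _ ->. Qed.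

Lemma derivation_scalar d (c : K) : derivation d -> d c%:A = 0.
Proof.
move=> dd; rewrite (linear_predZ (derivation_lin dd)).
suff -> : d 1 = 0 by rewrite scaler0.
by apply: (addrI (d 1)); rewrite addr0 -{3}[1]mulr1 derivationM // mulr1 mul1r.
Qed.

Lemma derivation_add d e :
  derivation d -> derivation e -> derivation (fun a => d a + e a).
Proof.
move=> [dl dM] [el eM]; split=> [c a b|a b].
  by rewrite dl el scalerDr addrACA.
by rewrite dM eM mulrDl mulrDr addrACA.
Qed.

Lemma derivation_scale (c : K) d : derivation d -> derivation (fun a => c *: d a).
Proof.
move=> [dl dM]; split=> [k a b|a b].
  by rewrite dl scalerDr !scalerA mulrC.
by rewrite dM scalerDr scalerAl scalerAr.
Qed.

Lemma derivation_opp d : derivation d -> derivation (fun a => - d a).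
Proof.
move=> /(derivation_scale (-1)).
by congr derivation; apply/funext => a; rewrite scaleN1r.
Qed.

Lemma derivation_sub d e :
  derivation d -> derivation e -> derivation (fun a => d a - e a).
Proof. by move=> dd ee; apply: derivation_add => //; exact: derivation_opp. Qed.

Lemma derivation_mull x d : derivation d -> derivation (fun a => x * d a).
Proof.
move=> [dl dM]; split=> [k a b|a b].
  by rewrite dl mulrDr scalerAr.
by rewrite dM; ring.
Qed.

Lemma derivation_zero : derivation (fun=> 0 : A).
Proof. by split=> [k a b|a b]; rewrite ?scaler0 ?mul0r ?mulr0 addr0. Qed.

Lemma derivation_sum I (r : seq I) (F : I -> A -> A) :
  (forall i, derivation (F i)) -> derivation (fun a => \sum_(i <- r) F i a).
Proof.
move=> FD; elim: r => [|i r IH].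
  by under eq_fun do rewrite big_nil; exact: derivation_zero.
by under eq_fun do rewrite big_cons; exact: derivation_add.
Qed.

Lemma derivation_commutator d e :
  derivation d -> derivation e -> derivation (fun a => d (e a) - e (d a)).
Proof.
move=> dd de; have [dl dM] := dd; have [el eM] := de; split=> [k a b|a b].
  by rewrite el !dl el scalerBr opprD addrACA.
by rewrite dM eM (linear_predD dl) (linear_predD el) !dM !eM; ring.
Qed.

End Derivations.

Section SymmetricAlgebra.
Variables (K : fieldType) (V : lmodType K).
Local Notation S := (symalg V).

(** The main tool on S(C): identities are arranged as equalities of two derivations in one argument,
    and so reduce to C. *)
Lemma symalg_derivation_eq (d e : S -> S) : derivation d -> derivation e ->
  (forall v, d (symin v) = e (symin v)) -> forall a, d a = e a.
Proof.
move=> dd de de_eq; apply: symalg_ind => [//|c|x y Ex Ey|x y Ex Ey].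
- by rewrite (derivation_scalar _ dd) (derivation_scalar _ de).
- by rewrite (linear_predD (derivation_lin dd)) (linear_predD (derivation_lin de)) Ex Ey.
- by rewrite (derivationM _ _ dd) (derivationM _ _ de) Ex Ey.
Qed.

(** The values lie in S(V), untouched factors entering through [sproj], so that invariance under
    [symeq] amounts to ring identities. *)
Fixpoint symterm_der (f : V -> S) (t : symterm V) : S :=
  match t with
  | SVar v => f v
  | SCst _ => 0
  | SAdd x y => symterm_der f x + symterm_der f y
  | SMul x y => symterm_der f x * sproj y + sproj x * symterm_der f y
  end.

Lemma symterm_der_eq (f : V -> S) : linear f ->
  forall s t, symeq s t -> symterm_der f s = symterm_der f t.
Proof.
move=> lf s t; elim=> {s t} /=.
- by [].
- by [].
- by move=> x y z _ -> _ ->.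
- by move=> x x' y y' _ -> _ ->.
- by move=> x x' y y' /sprojP-> -> /sprojP-> ->.
- by move=> x y z; rewrite addrA.
- by move=> x y; rewrite addrC.
- by move=> x; rewrite add0r.
- by move=> x; rewrite mul0r add0r sproj_cst scaleN1r mulN1r addNr.
- by move=> x y z; rewrite !sprojM; ring.
- by move=> x y; ring.
- by move=> x; rewrite mul0r add0r sproj_cst scale1r mul1r.
- by move=> x y z; rewrite !sprojD; ring.
- by move=> _ _; rewrite addr0.
- by move=> a b; rewrite mul0r mulr0 addr0.
- by move=> c u v; rewrite lf mul0r add0r sproj_cst mulr_algl.
Qed.

(** As [der_extend] is a choice by [xget], existence suffices: the Leibniz rule is applied to a
    representative term. *)
Lemma der_extendP (f : V -> S) : linear f ->
  derivation (der_extend f) /\ forall v, der_extend f (symin v) = f v.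
Proof.
move=> lf; suff /(xgetPex 0) : [set delta | derivation delta /\
    forall v, delta (symin v) = f v] !=set0 by [].
pose del (x : S) := symterm_der f (repr x).
have delE t : del (sproj t) = symterm_der f t.
  by apply: symterm_der_eq => //; exact: repr_sproj.
have delD x y : del (x + y) = del x + del y.
  by rewrite -[x]sproj_repr -[y]sproj_repr -sprojD !delE.
have delM x y : del (x * y) = del x * y + x * del y.
  by rewrite -[x]sproj_repr -[y]sproj_repr -sprojM !delE.
exists del; split=> [|v]; last exact: delE.
split=> [c x y|//]; rewrite delD -[c *: x]mulr_algl delM -sproj_cst delE.
by rewrite mul0r add0r sproj_cst mulr_algl.
Qed.

End SymmetricAlgebra.

(** * The symmetric algebra of a vertex Lie algebra *)

Section PoissonSymmetric.
Variables (K : fieldType) (C : lmodType K) (dC : {linear C -> C}).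
Variable YC : C -> C -> nat -> C.
Hypothesis char0 : forall n, n.+1%:R != 0 :> K.
Hypothesis YC_lie : vertex_lie dC YC.
Local Notation S := (symalg C).

(** With the two definitions below, this is [sconf_der], [sconf_Y0] and [sconf_Y] for an arbitrary
    vertex Lie algebra; at [conf_alg] they agree by unfolding. Applied to the degree operator of C,
    [sym_der] is also the Euler derivation. *)
Definition sym_der (a : S) : S := der_extend (fun u => symin (dC u)) a.
Definition sym_Y0 (u : C) (a : S) : nat -> S := fun n =>
  der_extend (fun v => symin (YC u v n)) a.
Definition sym_Y (a b : S) : nat -> S := fun n =>
  der_extend (fun u => sing_exp sym_der (ser_neg (sym_Y0 u a)) n) b.

Lemma sym_der_derivation : derivation sym_der.
Proof.
by have [|//] := @der_extendP _ _ (fun u => symin (dC u)); move=> c u v; rewrite !linearP.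
Qed.

Lemma sym_der_symin u : sym_der (symin u) = symin (dC u).
Proof.
have [|_ E] := @der_extendP _ _ (fun u => symin (dC u)); last exact: E.
by move=> c {}u v; rewrite !linearP.
Qed.

HB.instance Definition _ :=
  GRing.isLinear.Build K S S _ sym_der (derivation_lin sym_der_derivation).

Lemma sym_Y0_derivation u n : derivation (fun a => sym_Y0 u a n).
Proof.
have [|//] := @der_extendP _ _ (fun v => symin (YC u v n)).
by move=> c v w; rewrite (vl_linr YC_lie) linearP.
Qed.

Lemma sym_Y0_symin u v n : sym_Y0 u (symin v) n = symin (YC u v n).
Proof.
have [|_ E] := @der_extendP _ _ (fun v => symin (YC u v n)); last exact: E.
by move=> c {}v w; rewrite (vl_linr YC_lie) linearP.
Qed.

Lemma sym_Y0_lin a n : linear (fun u => sym_Y0 u a n).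
Proof.
move=> c u v; move: a; apply: symalg_derivation_eq.
- exact: sym_Y0_derivation.
- by apply/derivation_add/sym_Y0_derivation/derivation_scale/sym_Y0_derivation.
- by move=> w; rewrite !sym_Y0_symin (vl_linl YC_lie) linearP.
Qed.

Lemma sym_Y0_scalar u c : sym_Y0 u c%:A = 0.
Proof. by apply/funext => n; rewrite (derivation_scalar _ (sym_Y0_derivation u n)). Qed.

Lemma finite_seq_mul (x : S) f : finite_seq f -> finite_seq (fun n => x * f n).
Proof. by move=> [N fN]; exists N => n /fN ->; rewrite mulr0. Qed.

Lemma derivation_family_finite (F : nat -> S -> S) :
  (forall n, derivation (F n)) ->
  (forall u, finite_seq (fun n => F n (symin u))) ->
  forall a, finite_seq (fun n => F n a).
Proof.
move=> FD Ff; apply: symalg_ind => [//|c|x y fx fy|x y fx fy].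
- by exists 0%N => n _; rewrite (derivation_scalar _ (FD n)).
- have -> : (fun n => F n (x + y)) = (fun n => F n x) + (fun n => F n y).
    by apply/funext => n; rewrite (linear_predD (derivation_lin (FD n))).
  exact: finite_seqD.
- have -> : (fun n => F n (x * y)) = (fun n => y * F n x) + (fun n => x * F n y).
    by apply/funext => n; rewrite (derivationM _ _ (FD n)) [F n x * y]mulrC.
  by apply: finite_seqD; exact: finite_seq_mul.
Qed.

Lemma finite_seq_YC u v : finite_seq (YC u v).
Proof. exact: vl_trunc YC_lie u v. Qed.

Lemma finite_seq_symin f : finite_seq f -> finite_seq (fun n => symin (f n) : S).
Proof. by move=> [N fN]; exists N => n /fN ->; rewrite linear0. Qed.

Lemma finite_seq_Y0 u a : finite_seq (sym_Y0 u a).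
Proof.
apply: (derivation_family_finite (F := fun n a => sym_Y0 u a n)) => [n|v].
  exact: sym_Y0_derivation.
under eq_fun do rewrite sym_Y0_symin.
exact/finite_seq_symin/finite_seq_YC.
Qed.

Lemma YC_cov u v : YC u (dC v) = ser_cov dC (YC u v).
Proof.
apply: (Y_cov char0) => a b.
- exact: finite_seq_YC.
- exact: vl_deriv YC_lie a b.
- exact: vl_skew YC_lie a b.
Qed.

Lemma sym_Y0_cov u a : sym_Y0 u (sym_der a) = ser_cov sym_der (sym_Y0 u a).
Proof.
apply/funext => n; rewrite /ser_cov ser_derivE opprK.
(* A composite of derivations is not a derivation, but a commutator is: the terms are rearranged to
   bring one about. *)
apply/eqP; rewrite addrC -subr_eq; apply/eqP; move: a; apply: symalg_derivation_eq.
- exact: derivation_commutator (sym_Y0_derivation u n) sym_der_derivation.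
- exact/derivation_scale/sym_Y0_derivation.
- move=> v; rewrite sym_der_symin !sym_Y0_symin /= sym_der_symin YC_cov.
  rewrite /ser_cov ser_derivE opprK -linearB -linearZ/=.
  by congr symin; rewrite addrAC subrr add0r.
Qed.

Lemma sym_Y_derivation a n : derivation (fun b => sym_Y a b n).
Proof.
have [|//] := @der_extendP _ _
  (fun u => ser_skew sym_der (sym_Y0 u a) n) => c u v.
have -> : sym_Y0 (c *: u + v) a = c *: sym_Y0 u a + sym_Y0 v a.
  by apply/funext => k; rewrite sym_Y0_lin.
have f0 := finite_seq_Y0.
by rewrite (ser_skewD _ (finite_seqZ c (f0 u a)) (f0 v a)) (ser_skewZ _ _ (f0 u a)).
Qed.

Lemma sym_Y_symin a u n :
  sym_Y a (symin u) n = ser_skew sym_der (sym_Y0 u a) n.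
Proof.
have [|_ E] := @der_extendP _ _
  (fun u => ser_skew sym_der (sym_Y0 u a) n); last exact: E.
move=> c {}u v.
have -> : sym_Y0 (c *: u + v) a = c *: sym_Y0 u a + sym_Y0 v a.
  by apply/funext => k; rewrite sym_Y0_lin.
have f0 := finite_seq_Y0.
by rewrite (ser_skewD _ (finite_seqZ c (f0 u a)) (f0 v a)) (ser_skewZ _ _ (f0 u a)).
Qed.

Lemma sym_Y_linl b n : linear (fun a => sym_Y a b n).
Proof.
move=> c a a'; move: b; apply: symalg_derivation_eq.
- exact: sym_Y_derivation.
- by apply/derivation_add/sym_Y_derivation/derivation_scale/sym_Y_derivation.
- move=> u; rewrite !sym_Y_symin.
  have -> : sym_Y0 u (c *: a + a') = c *: sym_Y0 u a + sym_Y0 u a'.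
    by apply/funext => k; rewrite (derivation_lin (sym_Y0_derivation u k)).
  have f0 := finite_seq_Y0.
  by rewrite (ser_skewD _ (finite_seqZ c (f0 u a)) (f0 u a')) (ser_skewZ _ _ (f0 u a)).
Qed.

(** Both sides are derivations in b. On C the definition yields the skew transform of [YC v u],
    which is [YC u v] by skew symmetry in C. *)
Lemma sym_Y_siminl u b : sym_Y (symin u) b = sym_Y0 u b.
Proof.
apply/funext => n; move: b; apply: symalg_derivation_eq.
- exact: sym_Y_derivation.
- exact: sym_Y0_derivation.
- move=> v; rewrite sym_Y_symin sym_Y0_symin.
  rewrite (_ : sym_Y0 v (symin u) = fun n => symin (YC v u n)); last first.
    by apply/funext => k; rewrite sym_Y0_symin.
  rewrite (ser_skew_map char0 (D := dC)) ?(vl_skew YC_lie u v) //.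
    by move=> w; rewrite /= sym_der_symin.
  exact: finite_seq_YC.
Qed.

Lemma finite_seq_symY a b : finite_seq (sym_Y a b).
Proof.
apply: (derivation_family_finite (F := fun n b => sym_Y a b n)) => [n|u].
  exact: sym_Y_derivation.
under eq_fun do rewrite sym_Y_symin.
exact/finite_seq_skew/finite_seq_Y0.
Qed.

Lemma sym_Y_deriv a b : sym_Y (sym_der a) b = ser_deriv (sym_Y a b).
Proof.
apply/funext => n; rewrite ser_derivE; move: b; apply: symalg_derivation_eq.
- exact: sym_Y_derivation.
- exact/derivation_opp/derivation_scale/sym_Y_derivation.
- move=> u; rewrite !sym_Y_symin sym_Y0_cov.
  by rewrite (ser_skew_cov _ char0 (finite_seq_Y0 u a)) ser_derivE.
Qed.

(* [Sing ((exp(x D) b) f(x))] *)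
Definition exp_mul (b : S) (f : nat -> S) : nat -> S := fun n =>
  \sum_(i \in [set: nat]) divpow sym_der i b * f (n + i)%N.

Lemma exp_mulE N b f n : (forall i, (N <= i)%N -> f i = 0) ->
  exp_mul b f n = \sum_(i < N) divpow sym_der i b * f (n + i)%N.
Proof.
move=> fN; apply: fsbig_nat_bounded => i Ni.
by rewrite fN ?mulr0 // (leq_trans Ni) ?leq_addl.
Qed.

Lemma exp_mulD b f g : finite_seq f -> finite_seq g ->
  exp_mul b (f + g) = exp_mul b f + exp_mul b g.
Proof.
move=> [M fM] [N gN]; apply/funext => n; rewrite serE.
have fMN i : (M + N <= i)%N -> f i = 0.
  by move=> /(leq_trans (leq_addr _ _)) /fM.
have gMN i : (M + N <= i)%N -> g i = 0.
  by move=> /(leq_trans (leq_addl _ _)) /gN.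
rewrite (exp_mulE b n fMN) (exp_mulE b n gMN) (@exp_mulE (M + N)); last first.
  by move=> i iMN; rewrite serE fMN ?gMN // addr0.
by rewrite -big_split; apply: eq_bigr => i _; rewrite serE mulrDr.
Qed.

(** D - d/dx satisfies the Leibniz rule for products of series and annihilates e^(x D) b. *)
Lemma exp_mul_cov b f : finite_seq f ->
  exp_mul b (ser_cov sym_der f) = ser_cov sym_der (exp_mul b f).
Proof.
move=> [N fN]; apply/funext => n; rewrite /ser_cov ser_derivE opprK.
rewrite (exp_mulE b n fN) (@exp_mulE N.+1 b _ n.-1); last by move=> i /ltnW/fN.
rewrite (@exp_mulE N.+1); last first.
  move=> [//|i] Ni; rewrite ser_derivE !fN ?scaler0 ?oppr0 ?linear0 ?addr0 //.
  exact: ltnW.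
have DM a a' : sym_der (a * a') = sym_der a * a' + a * sym_der a'.
  exact: (derivationM _ _ sym_der_derivation).
transitivity (\sum_(i < N.+1) divpow sym_der i b * sym_der (f (n + i)%N)
   + (\sum_(i < N.+1) i%:R *: (divpow sym_der i b * f (n + i).-1)
   + \sum_(i < N.+1) n%:R *: (divpow sym_der i b * f (n + i).-1))).
  rewrite -!big_split; apply: eq_bigr => i _ /=.
  by rewrite ser_derivE opprK mulrDr natrD scalerDl mulrDr -!scalerAr [X in _ + X]addrC.
rewrite addrA; congr (_ + _).
  rewrite big_ord_recr /= fN ?leq_addl // !linear0 mulr0 addr0.
  rewrite big_ord_recl /= scale0r add0r -big_split linear_sum.
  apply: eq_bigr => i _; rewrite /= /bump leq0n add1n addnS DM addrC; congr (_ + _).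
  by rewrite scalerAl (divpowS _ char0).
case: n => [|n].
  by rewrite scale0r big1 // => i _; rewrite scale0r.
by rewrite scaler_sumr; apply: eq_bigr => i _; rewrite addSn.
Qed.

(** D being a derivation, e^(x D) is multiplicative. *)
Lemma ser_skew_mul b f : finite_seq f ->
  ser_skew sym_der (fun n => b * f n) = exp_mul b (ser_skew sym_der f).
Proof.
move: f; apply: (finite_seq_ind char0) => [f g ff fg Ef Eg|v|f ff Ef].
- have -> : (fun n => b * (f + g) n) =
      (fun n => b * f n) + (fun n => b * g n) :> (nat -> S).
    by apply/funext => n; rewrite !serE mulrDr.
  rewrite (ser_skewD _ (finite_seq_mul b ff) (finite_seq_mul b fg)) Ef Eg.
  rewrite (ser_skewD _ ff fg) exp_mulD //; exact: finite_seq_skew.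
- have -> : (fun n => b * mono_val 0 v n) = mono_val 0 (b * v).
    by apply/funext => n; rewrite /mono_val; case: eqP => // _; rewrite mulr0.
  rewrite !ser_skew_mono0; apply/funext => n; rewrite (@exp_mulE 1); last first.
    by move=> [|i] // _; rewrite serE oppr0.
  rewrite big_ord1 addn0 divpow0 !serE /mono_val.
  by case: eqP => _; rewrite ?oppr0 ?mulr0 ?mulrN.
- have -> : (fun n => b * ser_deriv f n) = ser_deriv (fun n => b * f n) :> (nat -> S).
    by apply/funext => n; rewrite !ser_derivE mulrN -scalerAr.
  rewrite (ser_skew_deriv _ char0 (finite_seq_mul b ff)) Ef ser_skew_deriv //.
  by rewrite exp_mul_cov //; exact: finite_seq_skew.
Qed.

(** The order of truncation depends on the argument; both rules are read off a finite sum long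
    enough for a and a' together. *)
Lemma derivation_exp_mul b (F : nat -> S -> S) n :
  (forall i, derivation (F i)) -> (forall a, finite_seq (fun i => F i a)) ->
  derivation (fun a => exp_mul b (fun i => F i a) n).
Proof.
move=> FD Ff.
have bound a a' : exists N, forall i, (N <= i)%N -> F i a = 0 /\ F i a' = 0.
  have [M fM] := Ff a; have [N fN] := Ff a'; exists (M + N)%N => i MNi.
  split; [apply: fM | apply: fN]; apply: leq_trans MNi.
    exact: leq_addr.
  exact: leq_addl.
have dsum N : derivation (fun a => \sum_(i < N) divpow sym_der i b * F (n + i)%N a).
  by apply: derivation_sum => i; exact: derivation_mull.
split=> [c a a'|a a']; have [N fN] := bound a a'.
- rewrite !(@exp_mulE N) => [|i /fN[] //|i /fN[] //|i /fN[E E']].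
    exact: (derivation_lin (dsum N)).
  by rewrite (derivation_lin (FD i)) E E' scaler0 addr0.
- rewrite !(@exp_mulE N) => [|i /fN[] //|i /fN[] //|i /fN[E E']].
    exact: (derivationM _ _ (dsum N)).
  by rewrite (derivationM _ _ (FD i)) E E' mul0r mulr0 addr0.
Qed.

Lemma sym_Y_mull b c a : sym_Y (b * c) a = exp_mul b (sym_Y c a) + exp_mul c (sym_Y b a).
Proof.
apply/funext => n; rewrite serE; move: a; apply: symalg_derivation_eq.
- exact: sym_Y_derivation.
- by apply: derivation_add; apply: derivation_exp_mul;
    do ?[exact: finite_seq_symY | move=> i; exact: sym_Y_derivation].
- move=> u; rewrite sym_Y_symin.
  have symYE a : sym_Y a (symin u) = ser_skew sym_der (sym_Y0 u a).
    by apply/funext => k; exact: sym_Y_symin.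
  have f0 := finite_seq_Y0 u.
  rewrite !symYE -!ser_skew_mul // -serE -ser_skewD; try exact: finite_seq_mul.
  congr (ser_skew _ _ n); apply/funext => k; rewrite serE.
  by rewrite (derivationM _ _ (sym_Y0_derivation u k)) mulrC addrC.
Qed.

Lemma sym_Y_skew a b : sym_Y a b = ser_skew sym_der (sym_Y b a).
Proof.
have YZ c d x n : sym_Y (c *: d) x n = c *: sym_Y d x n.
  exact: (linear_predZ (sym_Y_linl x n)).
move: b a; apply: symalg_ind => [u|c|x y Ex Ey|x y Ex Ey] a.
- by apply/funext => n; rewrite sym_Y_siminl sym_Y_symin.
- have -> : sym_Y c%:A a = 0.
    apply/funext => n; move: a.
    apply: symalg_derivation_eq => [||u].
    + exact: sym_Y_derivation.
    + exact: derivation_zero.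
    rewrite sym_Y_symin sym_Y0_scalar (@ser_skewE _ _ _ 0) ?big_ord0 //.
  apply/funext => n; rewrite (derivation_scalar _ (sym_Y_derivation a n)).
  by rewrite (@ser_skewE _ _ _ 0) ?big_ord0.
- have -> : sym_Y (x + y) a = sym_Y x a + sym_Y y a.
    by apply/funext => n; rewrite serE (linear_predD (sym_Y_linl a n)).
  rewrite ser_skewD; try exact: finite_seq_symY.
  rewrite -Ex -Ey; apply/funext => n; rewrite serE.
  by rewrite (linear_predD (derivation_lin (sym_Y_derivation a n))).
- have Exy z : (forall a, sym_Y a z = ser_skew sym_der (sym_Y z a)) ->
      sym_Y z a = ser_skew sym_der (sym_Y a z).
    by move=> ->; rewrite (ser_skewK _ char0 (finite_seq_symY z a)).
  rewrite sym_Y_mull (Exy x Ex) (Exy y Ey).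
  have fY z := finite_seq_symY a z.
  have fxy := finite_seq_mul x (fY y); have fyx := finite_seq_mul y (fY x).
  (* Read backwards, multiplicativity of e^(x D) turns the sum into the skew transform of x Y_a y +
     y Y_a x; applying the involution again leaves the Leibniz rule for Y_a. *)
  rewrite -!ser_skew_mul // -ser_skewD // (ser_skewK _ char0 (finite_seqD fxy fyx)).
  apply/funext => n; rewrite serE (derivationM _ _ (sym_Y_derivation a n)) addrC.
  by congr (_ + _); rewrite mulrC.
Qed.

Lemma sym_Y_jacobi a b c : jacobi sym_Y a b c.
Proof.
refine (@jacobi_generated K S sym_der sym_Y _ _ _ _ _ _ (range (@symin K C)) _ _ a b c).
- exact: char0.
- exact: sym_Y_linl.
- by move=> x n; exact: (derivation_lin (sym_Y_derivation x n)).
- exact: finite_seq_symY.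
- exact: sym_Y_deriv.
- exact: sym_Y_skew.
- move=> {}a {}b J {}c m n; move: c; apply: symalg_derivation_eq.
  + exact: derivation_commutator (sym_Y_derivation a m) (sym_Y_derivation b n).
  + under eq_fun do rewrite binom_ser1E.
    by apply: derivation_sum => i; exact/derivation_scale/sym_Y_derivation.
  + by move=> u; apply: J; exists u.
- move=> _ _ _ [u _ <-] [v _ <-] [w _ <-] m n.
  have YE x y k : sym_Y (symin x) (symin y) k = symin (YC x y k).
    by rewrite sym_Y_siminl sym_Y0_symin.
  rewrite !YE -linearB (vl_comm YC_lie) binom_ser1E linear_sum.
  by apply: eq_bigr => i _; rewrite linearZ/= !YE.
Qed.

Lemma sym_vertex_poisson : vertex_poisson sym_der sym_Y.
Proof.
split.
- exact: sym_der_derivation.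
- split.
  + exact: (derivation_lin sym_der_derivation).
  + exact: sym_Y_linl.
  + by move=> a n; exact: (derivation_lin (sym_Y_derivation a n)).
  + exact: finite_seq_symY.
  + exact: sym_Y_deriv.
  + exact: sym_Y_skew.
  + by move=> a b c m n; rewrite sym_Y_jacobi binom_ser1E.
- by move=> a b c n; exact: (derivationM _ _ (sym_Y_derivation a n)).
Qed.

End PoissonSymmetric.

(** * Gradings by Euler derivations *)

Section Span.
Variables (K : fieldType) (V : lmodType K).

Lemma lin_span_lin (P : set V) c u v :
  lin_span P u -> lin_span P v -> lin_span P (c *: u + v).
Proof.
move=> [s sP ->] [t tP ->]; exists ([seq (c * p.1, p.2) | p <- s] ++ t).
  by move=> p; rewrite mem_cat => /orP[/mapP[q /sP qP ->]|/tP].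
rewrite big_cat big_map /= scaler_sumr; congr (_ + _).
by apply: eq_bigr => p _; rewrite scalerA.
Qed.

Lemma lin_span0 (P : set V) : lin_span P 0.
Proof. by exists [::]; rewrite ?big_nil. Qed.

Lemma sub_lin_span (P : set V) : P `<=` lin_span P.
Proof.
move=> v Pv; exists [:: (1, v)]; last by rewrite big_seq1 scale1r.
by move=> p; rewrite inE => /eqP->.
Qed.

Lemma lin_span_ind (P Q : set V) : Q 0 ->
  (forall c u v, Q u -> Q v -> Q (c *: u + v)) -> P `<=` Q -> lin_span P `<=` Q.
Proof.
move=> Q0 Ql PQ _ [s sP ->]; rewrite big_seq.
elim/big_ind: _ => [//|u v Qu Qv|p /sP/PQ Qp]; last first.
  by rewrite -[_ *: _]addr0; exact: Ql.
by rewrite -[u]scale1r; exact: Ql.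
Qed.

End Span.

Section Eigenspaces.
Variables (K : fieldType) (V : lmodType K) (e : V -> V).
Hypothesis char0 : forall n, n.+1%:R != 0 :> K.
Hypothesis e_lin : linear e.

Lemma natr_sub_neq0 m n : m != n -> m%:R - n%:R != 0 :> K.
Proof.
wlog mn : m n / (n < m)%N => [H mn|_].
  have [nm|nm|/eqP] := ltngtP n m; [exact: H| |by rewrite eq_sym (negPf mn)].
  by rewrite -opprB oppr_eq0; apply: H => //; rewrite eq_sym.
by have := char0 (m - n).-1; rewrite prednK ?subn_gt0 // natrB // ltnW.
Qed.

(** The operator e - N kills the last term and multiplies the others by n - N, which is nonzero: the
    sum gets shorter. *)
Lemma eigenvector_sum_eq0 N (c : nat -> V) :
  (forall n, e (c n) = n%:R *: c n) -> \sum_(n < N) c n = 0 ->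
  forall n, (n < N)%N -> c n = 0.
Proof.
elim: N c => // N IH c ec cS.
have cN n : (n < N)%N -> c n = 0.
  move=> nN; pose c' n := (n%:R - N%:R) *: c n.
  have ec' k : e (c' k) = k%:R *: c' k.
    by rewrite /c' (linear_predZ e_lin) ec !scalerA mulrC.
  have cS' : \sum_(k < N) c' k = 0.
    transitivity (e (\sum_(k < N.+1) c k) - N%:R *: \sum_(k < N.+1) c k).
      rewrite (linear_pred_sum e_lin) scaler_sumr -sumrB big_ord_recr /=.
      rewrite ec subrr addr0; apply: eq_bigr => k _.
      by rewrite ec -scalerBl.
    by rewrite cS (linear_pred0 e_lin) scaler0 subr0.
  have /eqP := IH c' ec' cS' n nN; rewrite scaler_eq0 => /orP[|/eqP//].
  by rewrite (negPf (natr_sub_neq0 _)) ?ltn_eqF.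
move=> n; rewrite ltnS leq_eqVlt => /orP[/eqP->|/cN//].
by move: cS; rewrite big_ord_recr /= big1 ?add0r // => i _; exact: cN.
Qed.

(** The eigenvalue k is a scalar and not a natural number, so that negative integers are covered
    too; products of negative degree vanish in this way. *)
Lemma eigenvector_component N (c : nat -> V) (k : K) :
  (forall n, e (c n) = n%:R *: c n) ->
  e (\sum_(n < N) c n) = k *: \sum_(n < N) c n ->
  forall n, (n < N)%N -> n%:R != k -> c n = 0.
Proof.
move=> ec eS n nN nk; pose c' n := (n%:R - k) *: c n.
have ec' i : e (c' i) = i%:R *: c' i.
  by rewrite /c' (linear_predZ e_lin) ec !scalerA mulrC.
have cS' : \sum_(i < N) c' i = 0.
  transitivity (e (\sum_(i < N) c i) - k *: \sum_(i < N) c i).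
    rewrite (linear_pred_sum e_lin) scaler_sumr -sumrB; apply: eq_bigr => i _.
    by rewrite ec -scalerBl.
  by rewrite eS subrr.
have /eqP := eigenvector_sum_eq0 ec' cS' nN.
by rewrite scaler_eq0 subr_eq0 (negPf nk) => /eqP.
Qed.

End Eigenspaces.

(** * Commutation of the Euler derivation with D and Y *)

Section Euler.
Variables (K : fieldType) (C : lmodType K) (dC eC : {linear C -> C}).
Variable YC : C -> C -> nat -> C.
Hypothesis char0 : forall n, n.+1%:R != 0 :> K.
Hypothesis YC_lie : vertex_lie dC YC.
Hypothesis edC : forall u, eC (dC u) = dC (eC u) + dC u.
Hypothesis eYC : forall u v m,
  eC (YC u v m) = YC (eC u) v m + YC u (eC v) m - m.+1%:R *: YC u v m.
Local Notation S := (symalg C).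
Local Notation D := (sym_der dC).
Local Notation E := (sym_der eC).
Local Notation Y0 := (sym_Y0 YC).
Local Notation Y := (sym_Y dC YC).

Lemma euler_der a : E (D a) = D (E a) + D a.
Proof.
apply/eqP; rewrite addrC -subr_eq; apply/eqP.
move: a; apply: symalg_derivation_eq.
- exact: derivation_commutator (sym_der_derivation eC) (sym_der_derivation dC).
- exact: sym_der_derivation.
- by move=> u; rewrite !sym_der_symin edC linearD addrAC subrr add0r.
Qed.

Lemma euler_Y0 u a m :
  E (Y0 u a m) = Y0 (eC u) a m + Y0 u (E a) m - m.+1%:R *: Y0 u a m.
Proof.
rewrite addrAC; apply/eqP; rewrite -subr_eq; apply/eqP.
have Y0d v := sym_Y0_derivation YC_lie v m.
have Ed := sym_der_derivation eC.
move: a; apply: symalg_derivation_eq.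
- exact: derivation_commutator Ed (Y0d u).
- by apply: derivation_sub (Y0d _) _; exact/derivation_scale/Y0d.
- move=> v; rewrite !sym_der_symin !(sym_Y0_symin YC_lie) sym_der_symin eYC.
  by rewrite linearB linearD linearZ/= addrAC addrK.
Qed.

Lemma euler_divpow j a : E (divpow D j a) = divpow D j (E a) + j%:R *: divpow D j a.
Proof.
elim: j => [|j IH]; first by rewrite !divpow0 scale0r addr0.
have inj x y : j.+1%:R *: x = j.+1%:R *: y -> x = y :> S.
  by move=> /(congr1 (fun z => j.+1%:R^-1 *: z)); rewrite !scalerA mulVf ?scale1r.
have El := derivation_lin (sym_der_derivation eC).
have Dl := derivation_lin (sym_der_derivation dC).
apply: inj; rewrite scalerDr -(linear_predZ El) !divpowS // euler_der IH.
rewrite (linear_predD Dl) (linear_predZ Dl j%:R) -addrA; congr (_ + _).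
by rewrite -[in RHS]natr1 scalerDl scale1r.
Qed.

(** If x has degree -1, e^(x D) is homogeneous of degree 0, so [ser_skew] commutes with E - x d/dx.
    On the coefficient of x^(-k-1) this operator is E + k + 1; the constant 1 drops out. *)
Lemma euler_skew f n : finite_seq f ->
  E (ser_skew D f n) =
  ser_skew D (fun k => E (f k) + k%:R *: f k) n - n%:R *: ser_skew D f n.
Proof.
have El := derivation_lin (sym_der_derivation eC).
move=> [N fN].
have fNn j : (N <= j)%N -> f (n + j)%N = 0.
  by move=> Nj; rewrite fN // (leq_trans Nj) ?leq_addl.
rewrite !(@ser_skewE _ _ _ N) //; last first.
  by move=> j /fNn->; rewrite (linear_pred0 El) scaler0 addr0.
rewrite (linear_pred_sum El) scaler_sumr -sumrB; apply: eq_bigr => j _.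
rewrite (linear_predZ El) euler_divpow.
rewrite (linear_predD (divpow_is_linear D j)) divpowZ.
rewrite [n%:R *: _]scalerA [n%:R * _]mulrC -scalerA -scalerBr; congr (_ *: _).
by rewrite -addrA -scalerBl natrD addrAC subrr add0r.
Qed.

Lemma euler_Y a b m : E (Y a b m) = Y (E a) b m + Y a (E b) m - m.+1%:R *: Y a b m.
Proof.
rewrite addrAC; apply/eqP; rewrite -subr_eq; apply/eqP.
have Yd x := sym_Y_derivation YC_lie x m.
have Ed := sym_der_derivation eC.
move: b; apply: symalg_derivation_eq.
- exact: derivation_commutator Ed (Yd a).
- by apply: derivation_sub (Yd _) _; exact/derivation_scale/Yd.
- move=> u; rewrite !sym_der_symin !(sym_Y_symin YC_lie).
  have f0 v x := finite_seq_Y0 YC_lie v x.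
  rewrite euler_skew //.
  have -> : (fun k => E (Y0 u a k) + k%:R *: Y0 u a k) =
      Y0 (eC u) a + Y0 u (E a) - Y0 u a.
    apply/funext => k; rewrite euler_Y0 !serE -[k.+1%:R]natr1 scalerDl scale1r.
    by rewrite opprD addrA addrAC subrK.
  rewrite ser_skewB ?ser_skewD //; last exact: finite_seqD.
  rewrite !serE -[m.+1%:R]natr1 scalerDl scale1r opprD.
  by rewrite -!addrA addrC !addrA subrK -!addrA; congr (_ + _); rewrite addrC.
Qed.

End Euler.

Section EulerGrading.
Variables (K : fieldType) (C : lmodType K) (eC : {linear C -> C}).
Variable gr : nat -> set C.
Hypothesis char0 : forall n, n.+1%:R != 0 :> K.
Hypothesis gr_euler : forall n u, gr n u -> eC u = n%:R *: u.
Hypothesis gr_span : forall u, exists2 s : seq (nat * C),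
  {in s, forall p, gr p.1 p.2} & u = \sum_(p <- s) p.2.
Local Notation S := (symalg C).
Local Notation E := (sym_der eC).

Let E_lin : linear E := derivation_lin (sym_der_derivation eC).

Lemma sym_grading_euler n a : sym_grading gr n a -> E a = n%:R *: a.
Proof.
apply: (@lin_span_ind _ _ _ (fun a => E a = n%:R *: a)).
- by rewrite (linear_pred0 E_lin) scaler0.
- by move=> c u v Eu Ev; rewrite E_lin Eu Ev scalerDr !scalerA mulrC.
move=> _ [s [sgr <- ->]]; elim: s sgr => [|p s IH] sgr.
  by rewrite !big_nil scale0r -(scale1r 1) (derivation_scalar _ (sym_der_derivation eC)).
rewrite !big_cons (derivationM _ _ (sym_der_derivation eC)) IH; last first.
  by move=> q qs; apply: sgr; rewrite inE qs orbT.
rewrite sym_der_symin (gr_euler (sgr _ (mem_head _ _))) linearZ/=.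
by rewrite natrD scalerDl scalerAl scalerAr.
Qed.

Lemma sym_grading_mul m n a b :
  sym_grading gr m a -> sym_grading gr n b -> sym_grading gr (m + n) (a * b).
Proof.
move=> am; move: b; apply: lin_span_ind => [|c u v Gu Gv|_ [t [tgr <- ->]]].
- by rewrite mulr0; exact: lin_span0.
- by rewrite mulrDr -scalerAr; exact: lin_span_lin.
move: a am; apply: lin_span_ind => [|c u v Gu Gv|_ [s [sgr <- ->]]].
- by rewrite mul0r; exact: lin_span0.
- by rewrite mulrDl -scalerAl; exact: lin_span_lin.
apply: sub_lin_span; exists (s ++ t); split; rewrite ?big_cat //.
by move=> p; rewrite mem_cat => /orP[/sgr|/tgr].
Qed.

Lemma sym_grading_span a : exists N, exists2 c : nat -> S,
  (forall n, sym_grading gr n (c n)) & a = \sum_(n < N) c n.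
Proof.
(* Lists of homogeneous terms, with repeated degrees in any order, are easily closed under sums and
   products; terms of equal degree are collected only once, here. *)
suff [s sgr ->] : exists2 s : seq (nat * S),
    {in s, forall p, sym_grading gr p.1 p.2} & a = \sum_(p <- s) p.2.
  exists (\max_(p <- s) p.1).+1, (fun n => \sum_(p <- s | p.1 == n) p.2).
    move=> n; rewrite big_seq_cond.
    elim/big_ind: _ => [|u v Gu Gv|p /andP[/sgr Gp /eqP<-]] //.
      exact: lin_span0.
    by rewrite -[u]scale1r; exact: lin_span_lin.
  under [RHS]eq_bigr do rewrite big_mkcond.
  rewrite exchange_big big_seq [RHS]big_seq; apply: eq_bigr => p ps.
  have pN : (p.1 < (\max_(p <- s) p.1).+1)%N by rewrite ltnS leq_bigmax_seq.
  by rewrite -big_mkcond (big_pred1 (Ordinal pN)).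
move: a; apply: symalg_ind => [u|c|x y [s sgr ->] [t tgr ->]|x y [s sgr ->] [t tgr ->]].
- have [s sgr ->] := gr_span u; exists [seq (p.1, symin p.2) | p <- s].
    move=> _ /mapP[p /sgr Gp ->] /=; apply: sub_lin_span; exists [:: p].
    by rewrite !big_seq1; split=> // q; rewrite inE => /eqP->.
  by rewrite big_map linear_sum.
- exists [:: (0%N, c%:A)]; last by rewrite big_seq1.
  move=> p; rewrite inE => /eqP-> /=; exists [:: (c, 1)]; last by rewrite big_seq1.
  by move=> q; rewrite inE => /eqP->; exists [::]; rewrite !big_nil.
- exists (s ++ t); last by rewrite big_cat.
  by move=> p; rewrite mem_cat => /orP[/sgr|/tgr].
- exists [seq ((p.1 + q.1)%N, p.2 * q.2) | p <- s, q <- t].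
    move=> _ /allpairsP[[p q] /= [/sgr Gp /tgr Gq ->]]; exact: sym_grading_mul.
  by rewrite big_allpairs_dep big_distrlr.
Qed.

Lemma sym_gradingE n a : sym_grading gr n a <-> E a = n%:R *: a.
Proof.
split; first exact: sym_grading_euler.
have [N [c cgr ->]] := sym_grading_span a => Ec.
have cE k := sym_grading_euler (cgr k).
have c0 k : (k < N)%N -> k != n -> c k = 0.
  move=> kN kn; apply: (eigenvector_component char0 E_lin cE Ec kN).
  by rewrite -subr_eq0 natr_sub_neq0.
have [nN|Nn] := ltnP n N.
  rewrite (bigD1 (Ordinal nN)) //= big1 ?addr0 // => i ni.
  by apply: c0 => //; rewrite -val_eqE in ni.
rewrite big1 => [|i _]; first exact: lin_span0.
by apply: c0 => //; rewrite ltn_eqF // (leq_trans (ltn_ord i)).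
Qed.

Lemma euler_eigenvalue_ge0 n a : E a = - n.+1%:R *: a -> a = 0.
Proof.
have [N [c cgr ->]] := sym_grading_span a => Ec.
rewrite big1 // => i _; apply: (eigenvector_component char0 E_lin _ Ec) => //.
  by move=> k; exact: sym_grading_euler.
by rewrite -subr_eq0 opprK -natrD addnS char0.
Qed.

Lemma sym_algebra_grading : algebra_grading (sym_grading gr).
Proof.
split.
- by move=> n; exact: lin_span0.
- by move=> n c a b; exact: lin_span_lin.
- exact: sym_grading_span.
- move=> N c cgr; apply: (eigenvector_sum_eq0 char0 E_lin) => n.
  exact: sym_grading_euler.
- by apply: sub_lin_span; exists [::]; rewrite !big_nil.
- by move=> m n a b; exact: sym_grading_mul.
Qed.

Lemma sym_graded_vertex_poisson (dC : {linear C -> C}) (YC : C -> C -> nat -> C) :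
  vertex_lie dC YC ->
  (forall u, eC (dC u) = dC (eC u) + dC u) ->
  (forall u v m,
    eC (YC u v m) = YC (eC u) v m + YC u (eC v) m - m.+1%:R *: YC u v m) ->
  graded_vertex_poisson (sym_der dC) (sym_Y dC YC) (sym_grading gr).
Proof.
move=> Lie edC eYC; have VP := sym_vertex_poisson char0 Lie.
split=> //; first exact: sym_algebra_grading.
  move=> r a /sym_grading_euler Ea; apply/sym_gradingE.
  rewrite (euler_der edC) Ea (linear_predZ (derivation_lin (vp_der VP))).
  by rewrite -natr1 scalerDl scale1r.
move=> n r m a b /sym_grading_euler Ea /sym_grading_euler Eb.
have : E (sym_Y dC YC a b m) = (n%:R + r%:R - m.+1%:R) *: sym_Y dC YC a b m.
  rewrite (euler_Y char0 Lie edC eYC) Ea Eb.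
  rewrite (linear_predZ (vl_linl (vp_lie VP) b m)).
  by rewrite (linear_predZ (vl_linr (vp_lie VP) a m)) -scalerDl -scalerBl.
rewrite -natrD; case: ltnP => mnr EY.
  by apply/sym_gradingE; rewrite EY natrB.
(* With m >= n + r, the eigenvalue n + r - (m + 1) is -((m - (n + r)) + 1). *)
apply: (@euler_eigenvalue_ge0 (m - (n + r))).
by rewrite EY -subSn // natrB 1?leqW // opprB.
Qed.

End EulerGrading.

(** * The conformal products *)

Section PolyModule.
Variables (K : fieldType) (V : lmodType K).

Lemma polymodP (f g : polymod V) : (forall n, f n = g n) -> f = g.
Proof. by move=> fg; apply/val_inj/funext. Qed.

Lemma polymodD (f g : polymod V) n : (f + g) n = f n + g n. Proof. by []. Qed.
Lemma polymodZ c (f : polymod V) n : (c *: f) n = c *: f n. Proof. by []. Qed.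

Lemma polymod_finite (f : polymod V) : finite_seq f.
Proof. by case: f => f /= /asboolP. Qed.

Lemma shift_is_linear : linear (@shift K V).
Proof.
move=> c f g; apply: polymodP => n; rewrite polymodD polymodZ.
by case: n => //=; rewrite scaler0 addr0.
Qed.
HB.instance Definition _ :=
  GRing.isLinear.Build K (polymod V) (polymod V) _ (@shift K V) shift_is_linear.

Lemma mono_is_linear n : linear (@mono K V n).
Proof.
move=> c u v; apply: polymodP => m; rewrite polymodD polymodZ /= /mono_val.
by case: eqP => // _; rewrite scaler0 addr0.
Qed.
HB.instance Definition _ n :=
  GRing.isLinear.Build K V (polymod V) _ (@mono K V n) (mono_is_linear n).

Lemma shift_mono n (v : V) : shift (mono n v) = mono n.+1 v.
Proof. by apply: polymodP => -[|m]. Qed.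

Lemma polymod_sum_val I (r : seq I) (F : I -> polymod V) n :
  (\sum_(i <- r) F i) n = \sum_(i <- r) F i n.
Proof. by apply: (big_morph (fun f : polymod V => f n)). Qed.

Lemma polymod_mono (f : polymod V) N : (forall n, (N <= n)%N -> f n = 0) ->
  f = \sum_(n < N) mono n (f n).
Proof.
move=> fN; apply: polymodP => n; rewrite polymod_sum_val /= /mono_val.
rewrite -big_mkcond; have [nN|Nn] := ltnP n N.
  by rewrite (big_pred1 (Ordinal nN)).
by rewrite fN // big1 // => i /eqP ni; move: (ltn_ord i); rewrite -ni ltnNge Nn.
Qed.

Lemma polymod_mono_ind (P : polymod V -> Prop) :
  (forall f g, P f -> P g -> P (f + g)) -> (forall n v, P (mono n v)) ->
  forall f, P f.
Proof.
move=> PD Pm f; have [N fN] := polymod_finite f.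
rewrite (polymod_mono fN); elim/big_ind: _ => //.
by have := Pm 0%N 0; rewrite linear0.
Qed.

Lemma polymod_ind (P : polymod V -> Prop) :
  (forall f g, P f -> P g -> P (f + g)) -> (forall v, P (mono 0 v)) ->
  (forall f, P f -> P (shift f)) -> forall f, P f.
Proof.
move=> PD P0 PS; apply: polymod_mono_ind => //.
by elim=> // n IH v; rewrite -shift_mono; exact: PS.
Qed.

End PolyModule.

Lemma iter_linear (K : fieldType) (V : lmodType K) (h : V -> V) n :
  linear h -> linear (iter n h).
Proof. by move=> lh c u v; elim: n => //= n ->; rewrite lh. Qed.

Section IteratedCov.
Variables (K : fieldType) (V : lmodType K) (D : {linear V -> V}).
Hypothesis char0 : forall n, n.+1%:R != 0 :> K.

Lemma ser_cov_is_linear : linear (ser_cov D).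
Proof. by move=> c f g; rewrite ser_covD ser_covZ. Qed.

Lemma finite_seq_iter_deriv n (f : nat -> V) :
  finite_seq f -> finite_seq (iter n (@ser_deriv K V) f).
Proof. by move=> ff; elim: n => //= n; exact: finite_seq_deriv. Qed.

Lemma finite_seq_iter_cov n f : finite_seq f -> finite_seq (iter n (ser_cov D) f).
Proof. by move=> ff; elim: n => //= n; exact: finite_seq_cov. Qed.

Lemma iter_deriv_cov m n f :
  iter m (ser_cov D) (iter n (@ser_deriv K V) f) =
  iter n (@ser_deriv K V) (iter m (ser_cov D) f).
Proof.
elim: m => //= m ->; elim: n => //= n <-.
by rewrite ser_deriv_cov.
Qed.

Lemma ser_skew_iter_deriv n f : finite_seq f ->
  ser_skew D (iter n (@ser_deriv K V) f) = iter n (ser_cov D) (ser_skew D f).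
Proof.
move=> ff; elim: n => //= n <-; rewrite ser_skew_deriv //.
exact: finite_seq_iter_deriv.
Qed.

Lemma ser_skew_iter_cov n f : finite_seq f ->
  ser_skew D (iter n (ser_cov D) f) = iter n (@ser_deriv K V) (ser_skew D f).
Proof.
move=> ff; elim: n => //= n <-; rewrite ser_skew_cov //.
exact: finite_seq_iter_cov.
Qed.

End IteratedCov.

Section ConformalProducts.
Variables (K : fieldType) (A B : lmodType K).
Variables (d : {linear A -> B}) (op : 'I_2 -> A * B -> A * B -> A * B).
Hypothesis char0 : forall n, n.+1%:R != 0 :> K.
Hypothesis tc : truncated_conformal d op.
Local Notation AB := (A * B)%type.
Local Notation CAB := (polymod AB).
Local Notation D := (@shift K AB).
Local Notation cov := (ser_cov D).
Local Notation deriv := (@ser_deriv K CAB).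

(** The binomial theorem for (D - d/dx)^m, the two operators commuting. *)
Lemma Y0_left_cov u m v : Y0_left op u m v = iter m cov (Y0_base op u v).
Proof.
pose N := @ser_negderiv K A B.
have covE f k : cov f k = shift (f k) + N f k by [].
have NE f k : N f k = k%:R *: f k.-1 by rewrite /N /ser_negderiv ser_derivE opprK.
have N_cov j f k : iter j N (cov f) k = D (iter j N f k) + iter j.+1 N f k.
  elim: j k => //= j IH k; rewrite [LHS]NE IH scalerDr [N (N _) k]NE.
  by rewrite [N (iter j N f) k]NE [in RHS]linearZ.
have D_lin j : linear (iter j D) := iter_linear j (shift_is_linear (V := AB)).
apply/funext => n; rewrite /Y0_left -/N.
elim: m (Y0_base op u v) n => [|m IH] f n.
  by rewrite big_ord1 bin0 scale1r.
rewrite iterSr -IH; under [RHS]eq_bigr => j _ do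
  rewrite N_cov (linear_predD (D_lin j)) -iterSr scalerDr.
rewrite big_split /= [LHS]big_ord_recl [X in _ = _ + X]big_ord_recl.
under [X in _ + X = _]eq_bigr => j _ do rewrite lift0 binS natrD scalerDl subSS.
rewrite [X in _ + X = _]big_split /= [X in _ + (X + _)]big_ord_recr /=.
rewrite (bin_small (ltnSn m)) scale0r addr0.
rewrite [X in _ + X = _]addrC addrCA; congr (_ + _).
rewrite !bin0 !subn0; congr (_ + _); apply: eq_bigr => j _.
by rewrite /bump leq0n add1n -[N (iter _ N f)]iterS subnSK.
Qed.

Lemma Y0_base_lin2 u n : linear (fun v => Y0_base op u v n).
Proof.
move=> c v w; case: n => [|[|n]] /=; rewrite ?scaler0 ?addr0 //.
  by rewrite (tc_linr tc) linearP.
by rewrite (tc_linr tc) linearP.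
Qed.

Lemma Y0_base_lin1 v n : linear (fun u => Y0_base op u v n).
Proof.
move=> c u w; case: n => [|[|n]] /=; rewrite ?scaler0 ?addr0 //.
  by rewrite (tc_linl tc) linearP.
by rewrite (tc_linl tc) linearP.
Qed.

Lemma finite_seq_base u v : finite_seq (Y0_base op u v).
Proof. by exists 2%N => -[|[|n]]. Qed.

(* [Y^0_-(D^n u, x) v] is defined through [Y^0_-(v, x) D^n u] when [n > 0], so
   that its initial value is then the transposed product. *)
Definition Y0_seed n u v : nat -> CAB :=
  if n is 0 then Y0_base op u v else ser_skew D (Y0_base op v u).

(** For n > 0 the definition applies d/dx and D - d/dx to the transposed product, with the roles of
    m and n exchanged; [ser_skew] exchanges them back. Only the seed remembers whether n is 0. *)
Lemma Y0_monoE n u m v :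
  Y0_mono op n u m v = iter n deriv (iter m cov (Y0_seed n u v)).
Proof.
case: n => [|n]; first by rewrite /= Y0_left_cov.
(* The chain rule: -d/dx (f(-x)) = f'(-x). *)
have neg_deriv f : ser_negderiv (ser_neg f) = ser_neg (deriv f).
  apply/funext => k; rewrite /ser_negderiv /ser_neg !ser_derivE opprK.
  case: k => [|k]; first by rewrite !scale0r oppr0 scaler0.
  by rewrite scalerN [(-1) ^+ k.+2]exprS mulN1r scaleNr opprK !scalerA mulrC.
have iter_neg_deriv f : iter m (@ser_negderiv K A B) (ser_neg f) =
    ser_neg (iter m deriv f).
  by elim: m => //= m ->; rewrite neg_deriv.
rewrite /Y0_mono iter_neg_deriv -/(ser_skew D _) Y0_left_cov.
have fb := finite_seq_base v u; have fc := finite_seq_iter_cov D n.+1 fb.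
by rewrite ser_skew_iter_deriv // ser_skew_iter_cov // iter_deriv_cov.
Qed.

Lemma Y0_seed_lin1 n v : linear (fun u => Y0_seed n u v).
Proof.
move=> c u w; apply/funext => k; case: n => [|n]; rewrite /= !serE.
  exact: Y0_base_lin1.
have -> : Y0_base op v (c *: u + w) = c *: Y0_base op v u + Y0_base op v w.
  by apply/funext => i; exact: Y0_base_lin2.
have fb x := finite_seq_base v x.
by rewrite (ser_skewD _ (finite_seqZ c (fb u)) (fb w)) (ser_skewZ _ _ (fb u)).
Qed.

Lemma Y0_seed_lin2 n u : linear (fun v => Y0_seed n u v).
Proof.
move=> c v w; apply/funext => k; case: n => [|n]; rewrite /= !serE.
  exact: Y0_base_lin2.
have -> : Y0_base op (c *: v + w) u = c *: Y0_base op v u + Y0_base op w u.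
  by apply/funext => i; exact: Y0_base_lin1.
have fb x := finite_seq_base x u.
by rewrite (ser_skewD _ (finite_seqZ c (fb v)) (fb w)) (ser_skewZ _ _ (fb v)).
Qed.

Lemma Y0_mono_lin1 n m v k : linear (fun u => Y0_mono op n u m v k).
Proof.
move=> c u w; rewrite !Y0_monoE Y0_seed_lin1.
rewrite (iter_linear m (ser_cov_is_linear D)) //.
by rewrite (iter_linear n (@ser_deriv_is_linear K CAB)).
Qed.

Lemma Y0_mono_lin2 n u m k : linear (fun v => Y0_mono op n u m v k).
Proof.
move=> c v w; rewrite !Y0_monoE Y0_seed_lin2.
rewrite (iter_linear m (ser_cov_is_linear D)) //.
by rewrite (iter_linear n (@ser_deriv_is_linear K CAB)).
Qed.

Lemma Y0E N (f g : CAB) k :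
  (forall n, (N <= n)%N -> f n = 0) -> (forall n, (N <= n)%N -> g n = 0) ->
  Y0 op f g k = \sum_(n < N) \sum_(m < N) Y0_mono op n (f n) m (g m) k.
Proof.
move=> fN gN; rewrite /Y0.
have Sm n : \sum_(m \in [set: nat]) Y0_mono op n (f n) m (g m) k =
    \sum_(m < N) Y0_mono op n (f n) m (g m) k.
  apply: fsbig_nat_bounded => m /gN ->.
  exact: (linear_pred0 (Y0_mono_lin2 _ _ _ _)).
rewrite (@fsbig_nat_bounded _ _ N) => [|n /fN fn0].
  by apply: eq_bigr => n _; exact: Sm.
rewrite Sm big1 // => m _; rewrite fn0.
exact: (linear_pred0 (Y0_mono_lin1 _ _ _ _)).
Qed.

Lemma Y0_lin1 g k : linear (fun f => Y0 op f g k).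
Proof.
move=> c f h; have [M fM] := polymod_finite f.
have [N hN] := polymod_finite h; have [P gP] := polymod_finite g.
have {}fM n : (M + N + P <= n)%N -> f n = 0.
  by rewrite -addnA => /(leq_trans (leq_addr _ _)); exact: fM.
have {}hN n : (M + N + P <= n)%N -> h n = 0.
  by rewrite -addnA addnCA => /(leq_trans (leq_addr _ _)); exact: hN.
have {}gP n : (M + N + P <= n)%N -> g n = 0.
  by move=> /(leq_trans (leq_addl _ _)); exact: gP.
rewrite (Y0E k fM gP) (Y0E k hN gP) (@Y0E (M + N + P)) //; last first.
  by move=> n nP; rewrite polymodD polymodZ fM // hN // scaler0 addr0.
rewrite scaler_sumr -big_split; apply: eq_bigr => n _ /=.
rewrite scaler_sumr -big_split; apply: eq_bigr => m _ /=.
exact: Y0_mono_lin1.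
Qed.

Lemma Y0_lin2 f k : linear (fun g => Y0 op f g k).
Proof.
move=> c g h; have [M fM] := polymod_finite f.
have [N hN] := polymod_finite h; have [P gP] := polymod_finite g.
have {}fM n : (M + N + P <= n)%N -> f n = 0.
  by rewrite -addnA => /(leq_trans (leq_addr _ _)); exact: fM.
have {}hN n : (M + N + P <= n)%N -> h n = 0.
  by rewrite -addnA addnCA => /(leq_trans (leq_addr _ _)); exact: hN.
have {}gP n : (M + N + P <= n)%N -> g n = 0.
  by move=> /(leq_trans (leq_addl _ _)); exact: gP.
rewrite (Y0E k fM gP) (Y0E k fM hN) (@Y0E (M + N + P)) //; last first.
  by move=> n nP; rewrite polymodD polymodZ gP // hN // scaler0 addr0.
rewrite scaler_sumr -big_split; apply: eq_bigr => n _ /=.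
rewrite scaler_sumr -big_split; apply: eq_bigr => m _ /=.
exact: Y0_mono_lin2.
Qed.

Lemma Y0_monomial n u m v k : Y0 op (mono n u) (mono m v) k = Y0_mono op n u m v k.
Proof.
have mono_gt i w j : (i < j)%N -> mono i w j = 0 :> AB.
  by move=> ij; rewrite /= /mono_val gtn_eqF.
have nN : (n < (n + m).+1)%N by rewrite ltnS leq_addr.
have mN : (m < (n + m).+1)%N by rewrite ltnS leq_addl.
rewrite (@Y0E (n + m).+1) => [|j /(leq_trans nN)|j /(leq_trans mN)]; last 2 first.
- exact: mono_gt.
- exact: mono_gt.
have diag i w : mono i w i = w :> AB by rewrite /= /mono_val eqxx.
have offdiag i w j : j != i -> mono i w j = 0 :> AB.
  by rewrite /= /mono_val => /negPf->.
rewrite (bigD1 (Ordinal nN)) //= [X in _ + X]big1 ?addr0 => [|i ni]; last first.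
  rewrite big1 // => j _; rewrite [mono_val n u i](offdiag n u i ni).
  exact: (linear_pred0 (Y0_mono_lin1 _ _ _ _)).
rewrite (bigD1 (Ordinal mN)) //= [X in _ + X]big1 ?addr0 => [|j mj]; last first.
  rewrite [mono_val m v j](offdiag m v j mj).
  exact: (linear_pred0 (Y0_mono_lin2 _ _ _ _)).
by rewrite [mono_val n u n](diag n u) [mono_val m v m](diag m v).
Qed.

End ConformalProducts.

(** * Products in a 1-truncated conformal algebra *)

Section TruncatedConformalTheory.
Variables (K : fieldType) (A B : lmodType K).
Variables (d : {linear A -> B}) (op : 'I_2 -> A * B -> A * B -> A * B).
Hypothesis tc : truncated_conformal d op.
Local Notation AB := (A * B)%type.

Lemma in01_split (u : AB) : u = in0 u.1 + in1 u.2.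
Proof. by case: u => a b; congr pair; rewrite /= ?addr0 ?add0r. Qed.

Lemma op_split i u v : op i u v =
  op i (in0 u.1) (in0 v.1) + op i (in0 u.1) (in1 v.2) +
  (op i (in1 u.2) (in0 v.1) + op i (in1 u.2) (in1 v.2)).
Proof.
rewrite -!(linear_predD (tc_linr tc i _)) -!in01_split.
by rewrite -(linear_predD (tc_linl tc i _)) -in01_split.
Qed.

Let deg0 (a : A) : tc_deg 0 (in0 a : AB). Proof. by []. Qed.
Let deg1 (b : B) : tc_deg 1 (in1 b : AB). Proof. by []. Qed.

(** Here and in the next lemmas [tc_homog] places the product in degree p + q - i - 1, where only
    degrees 0 and 1 are nonzero. This recovers the four-case description of the products. *)
Lemma op00 i a a' : op i (in0 a) (in0 a') = 0.
Proof.
have := tc_homog tc i (deg0 a) (deg0 a').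
by case: i => -[|[|//]] i2.
Qed.

Lemma op0_in01 a b : (op ord0 (in0 a) (in1 b)).2 = 0.
Proof. exact: (tc_homog tc ord0 (deg0 a) (deg1 b)). Qed.

Lemma op0_in10 b a : (op ord0 (in1 b) (in0 a)).2 = 0.
Proof. exact: (tc_homog tc ord0 (deg1 b) (deg0 a)). Qed.

Lemma op0_in11 b b' : (op ord0 (in1 b) (in1 b')).1 = 0.
Proof. exact: (tc_homog tc ord0 (deg1 b) (deg1 b')). Qed.

Lemma op1_in01 a b : op ord_max (in0 a) (in1 b) = 0.
Proof. exact: (tc_homog tc ord_max (deg0 a) (deg1 b)). Qed.

Lemma op1_in10 b a : op ord_max (in1 b) (in0 a) = 0.
Proof. exact: (tc_homog tc ord_max (deg1 b) (deg0 a)). Qed.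

Lemma op1_in11 b b' : (op ord_max (in1 b) (in1 b')).2 = 0.
Proof. exact: (tc_homog tc ord_max (deg1 b) (deg1 b')). Qed.

Lemma op1E u v : op ord_max u v = op ord_max (in1 u.2) (in1 v.2).
Proof. by rewrite op_split op00 op1_in01 op1_in10 !add0r. Qed.

Lemma op1_in0l a v : op ord_max (in0 a) v = 0.
Proof. by rewrite op1E linear0 (linear_pred0 (tc_linl tc _ _)). Qed.

Lemma op1_in0r u a : op ord_max u (in0 a) = 0.
Proof. by rewrite op1E linear0 (linear_pred0 (tc_linr tc _ _)). Qed.

Lemma op1_in0 u v : op ord_max u v = in0 (op ord_max u v).1.
Proof. by rewrite op1E; move: (op1_in11 u.2 v.2); case: op => a b /= ->. Qed.

Lemma op1_sym u v : op ord_max u v = op ord_max v u.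
Proof. by rewrite op1E (tc_skew1 tc) -op1E. Qed.

Lemma op0E u v : op ord0 u v = op ord0 (in0 u.1) (in1 v.2) +
  op ord0 (in1 u.2) (in0 v.1) + op ord0 (in1 u.2) (in1 v.2).
Proof. by rewrite op_split op00 add0r addrA. Qed.

(** The mixed axioms lack the correction term in [d]; they fit the same formula because [op ord_max]
    sees only the components in B. *)
Lemma op0_skew u v :
  op ord0 u v = - op ord0 v u + in1 (d (op ord_max v u).1).
Proof.
rewrite (op0E u) (op0E v) (tc_skew0 tc u.2) (tc_skew01 tc v.1 u.2).
rewrite (tc_skew01 tc u.1 v.2) -op1E addrA; congr (_ + _).
by rewrite !opprD opprK; congr (_ - _); rewrite addrC.
Qed.

Definition opn n u v : AB :=
  if n is n'.+1 then if n' is 0 then op ord_max u v else 0 else op ord0 u v.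

Lemma Y0_baseE u v n : Y0_base op u v n = mono 0 (opn n u v).
Proof. by case: n => [|[|n]] //=; rewrite linear0. Qed.

Lemma opn0l n v : opn n 0 v = 0.
Proof. by case: n => [|[|n]] //=; exact: (linear_pred0 (tc_linl tc _ _)). Qed.

Lemma opn0r n u : opn n u 0 = 0.
Proof. by case: n => [|[|n]] //=; exact: (linear_pred0 (tc_linr tc _ _)). Qed.

(** The map u -> [in1 u.2] is the degree operator of A + B: 0 on A and 1 on B. *)
Lemma opn_euler n u v : in1 (opn n u v).2 =
  opn n (in1 u.2) v + opn n u (in1 v.2) - n.+1%:R *: opn n u v.
Proof.
case: n => [|[|n]] /=; last by rewrite scaler0 subr0 addr0 linear0.
- rewrite scale1r op0E [op _ (in1 _) v]op0E [op _ u (in1 _)]op0E !linear0.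
  rewrite !(linear_pred0 (tc_linl tc _ _)) !(linear_pred0 (tc_linr tc _ _)).
  rewrite /= !add0r !addr0; set x := op _ _ _; set y := op _ _ _; set z := op _ _ _.
  have -> : in1 (x + y + z).2 = z.
    rewrite /= op0_in01 op0_in10 !add0r [RHS]in01_split op0_in11.
    by rewrite linear0 add0r.
  by apply/esym/eqP; rewrite subr_eq addrACA (addrC y) addrA addrC.
- rewrite op1_in0 [op _ (in1 _) v]op1E [op _ u (in1 _)]op1E /= linear0.
  by rewrite scaler_nat mulr2n -op1E -op1_in0 subrr.
Qed.
End TruncatedConformalTheory.

(** * Descent of D and of the products to C *)

Section ConformalAlgebra.
Variables (K : fieldType) (A B : lmodType K).
Variables (d : {linear A -> B}) (op : 'I_2 -> A * B -> A * B -> A * B).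
Hypothesis char0 : forall n, n.+1%:R != 0 :> K.
Hypothesis tc : truncated_conformal d op.
Local Notation AB := (A * B)%type.
Local Notation CAB := (polymod AB).
Local Notation C := (conf_alg d).

Definition cls (f : CAB) : C := qproj (dhat d) f.

Lemma cls_is_linear : linear cls.
Proof. exact: qproj_is_linear. Qed.
HB.instance Definition _ := GRing.isLinear.Build K CAB C _ cls cls_is_linear.

Lemma cls_repr (x : C) : cls (repr x) = x.
Proof. exact: qproj_repr. Qed.

Lemma clsP f g : cls f = cls g <-> exists w, dhat d w = f - g.
Proof.
rewrite /cls; split=> [/eqP|[w wE]]; first by rewrite qproj_eq => /asboolP.
by apply/eqP; rewrite qproj_eq; apply/asboolP; exists w.
Qed.

Lemma dhatE (w : polymod A) n :
  dhat d w n = in1 (d (w n)) - (if n is n'.+1 then in0 (w n') else 0).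
Proof. by []. Qed.

Lemma dhat_shift w : dhat d (shift w) = shift (dhat d w).
Proof.
apply: polymodP => -[|n]; rewrite dhatE /=.
  by rewrite !linear0 addr0.
by case: n => [|n] //=; rewrite dhatE.
Qed.

Lemma conf_derE f : conf_der (cls f) = cls (shift f).
Proof.
rewrite /conf_der -/(cls _).
have /clsP[w wE] := cls_repr (cls f).
by apply/clsP; exists (shift w); rewrite dhat_shift wE linearB.
Qed.

Lemma conf_der_is_linear : linear (@conf_der K A B d).
Proof.
move=> c x y; rewrite -[x]cls_repr -[y]cls_repr -cls_is_linear !conf_derE.
by rewrite shift_is_linear cls_is_linear.
Qed.
HB.instance Definition _ :=
  GRing.isLinear.Build K C C _ (@conf_der K A B d) conf_der_is_linear.
Local Notation D := (@conf_der K A B d).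

Definition gen (u : AB) : C := cls (mono 0 u).

Lemma gen_is_linear : linear gen.
Proof. by move=> c u v; rewrite /gen mono_is_linear cls_is_linear. Qed.
HB.instance Definition _ := GRing.isLinear.Build K AB C _ gen gen_is_linear.

Lemma dhat_mono n a :
  dhat d (mono n a) = mono n (in1 (d a)) - mono n.+1 (in0 a).
Proof.
rewrite /dhat -shift_mono; congr (_ - shift _); apply: polymodP => k;
  by rewrite /= /mono_val; case: eqP => // _; rewrite !linear0.
Qed.

Lemma conf_der_gen a : D (gen (in0 a)) = gen (in1 (d a)).
Proof.
rewrite /gen conf_derE; apply/esym/clsP; exists (mono 0 a).
by rewrite shift_mono; exact: dhat_mono.
Qed.

(** At index 0 the axiom u_0 v = - v_0 u + [d (v_1 u)] becomes skew symmetry once [d] is identified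
    with D on A, that is, in the quotient. *)
Lemma skew_gen u v :
  ser_skew D (fun n => gen (opn op n u v)) = fun n => gen (opn op n v u).
Proof.
apply/funext => -[|n].
  rewrite (@ser_skewE _ _ _ 2) => [|[|[|j]]//= _]; last exact: linear0.
  rewrite big_ord_recl big_ord1 /= divpow0 add0n /divpow /= invr1 scale1r.
  rewrite expr1 scaleN1r sqrrN expr1n scale1r (op1_in0 tc) conf_der_gen.
  by rewrite (op0_skew tc v) linearD linearN.
rewrite (@ser_skewE _ _ _ 1) => [|[|j]//= _]; last first.
  by rewrite addnS /=; exact: linear0.
rewrite big_ord1 addn0 divpow0; case: n => [|n] /=.
  by rewrite sqrrN expr1n scale1r (op1_sym tc).
by rewrite linear0 scaler0.
Qed.

(** An intermediate stage: values in C, where skew symmetry holds, but arguments in C(A + B), so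
    that nothing has to be well defined yet. *)
Definition cls_Y f g : nat -> C := fun n => cls (Y0 op f g n).

Lemma cls_Y_lin1 g n : linear (fun f => cls_Y f g n).
Proof. by move=> c f h; rewrite /cls_Y (Y0_lin1 char0 tc) cls_is_linear. Qed.

Lemma cls_Y_lin2 f n : linear (fun g => cls_Y f g n).
Proof. by move=> c g h; rewrite /cls_Y (Y0_lin2 char0 tc) cls_is_linear. Qed.

Lemma cls_Y_D1 f h g : cls_Y (f + h) g = cls_Y f g + cls_Y h g.
Proof. by apply/funext => n; rewrite (linear_predD (cls_Y_lin1 g n)). Qed.

Lemma cls_Y_D2 f g h : cls_Y f (g + h) = cls_Y f g + cls_Y f h.
Proof. by apply/funext => n; rewrite (linear_predD (cls_Y_lin2 f n)). Qed.

(** By [skew_gen] the seeds for n = 0 and n > 0 have the same class, which makes the formula uniform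
    in n. *)
Lemma cls_Y_mono n u m v : cls_Y (mono n u) (mono m v) =
  iter n (@ser_deriv K C) (iter m (ser_cov D) (fun k => gen (opn op k u v))).
Proof.
have cls_deriv f : (fun k => cls (ser_deriv f k)) = ser_deriv (fun k => cls (f k)).
  by apply/funext => k; rewrite !ser_derivE linearN linearZ.
have cls_cov f : (fun k => cls (ser_cov (@shift K AB) f k)) =
    ser_cov D (fun k => cls (f k)).
  apply/funext => k; rewrite /ser_cov linearB /= conf_derE; congr (_ - _).
  exact: (congr1 (@^~ k) (cls_deriv f)).
have cls_seed : (fun k => cls (Y0_seed op n u v k)) = fun k => gen (opn op k u v).
  case: n => [|n]; first by apply/funext => k; rewrite /= Y0_baseE.
  rewrite -skew_gen /= -(ser_skew_map char0 (h := cls) (D := @shift K AB) (D' := D)).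
  - by congr (ser_skew _ _); apply/funext => k; rewrite Y0_baseE.
  - by move=> f; rewrite /= conf_derE.
  - exact: finite_seq_base.
rewrite -cls_seed /cls_Y.
have -> : Y0 op (mono n u) (mono m v) = iter n (@ser_deriv K CAB)
    (iter m (ser_cov (@shift K AB)) (Y0_seed op n u v)).
  by apply/funext => k; rewrite (Y0_monomial char0 tc) Y0_monoE.
elim: n {cls_seed} (Y0_seed op n u v) => [|n IH] f /=; last by rewrite cls_deriv IH.
by elim: m => //= m IH; rewrite cls_cov IH.
Qed.

Lemma cls_Y_shift1 f g : cls_Y (shift f) g = ser_deriv (cls_Y f g).
Proof.
move: f; apply: polymod_mono_ind => [f f' Ef Ef'|n u].
  by rewrite linearD !cls_Y_D1 ser_derivD Ef Ef'.
move: g; apply: polymod_mono_ind => [g g' Eg Eg'|m v].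
  by rewrite !cls_Y_D2 ser_derivD Eg Eg'.
by rewrite shift_mono !cls_Y_mono.
Qed.

Lemma cls_Y_shift2 f g : cls_Y f (shift g) = ser_cov D (cls_Y f g).
Proof.
move: f; apply: polymod_mono_ind => [f f' Ef Ef'|n u].
  by rewrite !cls_Y_D1 ser_covD Ef Ef'.
move: g; apply: polymod_mono_ind => [g g' Eg Eg'|m v].
  by rewrite linearD !cls_Y_D2 ser_covD Eg Eg'.
by rewrite shift_mono !cls_Y_mono -[ser_cov D _]/(iter 1 (ser_cov D) _) iter_deriv_cov.
Qed.

Lemma cls_Y_gen u v : cls_Y (mono 0 u) (mono 0 v) = fun k => gen (opn op k u v).
Proof. exact: cls_Y_mono. Qed.

Lemma finite_seq_gen u v : finite_seq (fun k => gen (opn op k u v)).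
Proof. by exists 2%N => -[|[|k]]// _; rewrite /= linear0. Qed.

Lemma cls_Y_ind (P : CAB -> CAB -> Prop) :
  (forall f f' g, P f g -> P f' g -> P (f + f') g) ->
  (forall f g g', P f g -> P f g' -> P f (g + g')) ->
  (forall u v, P (mono 0 u) (mono 0 v)) ->
  (forall f g, P f g -> P (shift f) g) ->
  (forall f g, P f g -> P f (shift g)) ->
  forall f g, P f g.
Proof.
move=> PD1 PD2 P0 PS1 PS2 f; move: f; apply: polymod_ind => [f f' Pf Pf' g|u|f Pf g].
- by apply: PD1.
- by apply: polymod_ind => [g g' Pg Pg'|v|g Pg]; [exact: PD2|exact: P0|exact: PS2].
- exact: PS1.
Qed.

Lemma finite_seq_cls_Y f g : finite_seq (cls_Y f g).
Proof.
move: f g; apply: cls_Y_ind => [f f' g Ff Ff'|f g g' Fg Fg'|u v|f g Ff|f g Fg].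
- by rewrite cls_Y_D1; exact: finite_seqD.
- by rewrite cls_Y_D2; exact: finite_seqD.
- by rewrite cls_Y_gen; exact: finite_seq_gen.
- by rewrite cls_Y_shift1; exact: finite_seq_deriv.
- by rewrite cls_Y_shift2; exact: finite_seq_cov.
Qed.

Lemma cls_Y_skew f g : cls_Y f g = ser_skew D (cls_Y g f).
Proof.
have fY := finite_seq_cls_Y.
move: f g; apply: cls_Y_ind => [f f' g Ef Ef'|f g g' Eg Eg'|u v|f g Ef|f g Eg].
- by rewrite cls_Y_D1 cls_Y_D2 ser_skewD // Ef Ef'.
- by rewrite cls_Y_D1 cls_Y_D2 ser_skewD // Eg Eg'.
- by rewrite !cls_Y_gen skew_gen.
- by rewrite cls_Y_shift1 cls_Y_shift2 ser_skew_cov // Ef.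
- by rewrite cls_Y_shift1 cls_Y_shift2 ser_skew_deriv // Eg.
Qed.

(** On generators this is (d a)_0 = 0 and (d a)_1 = - a_0: the series of [d a] is the derivative of
    that of a, as for D a. *)
Lemma cls_Y_dhat1 w g : cls_Y (dhat d w) g = 0.
Proof.
have ser_deriv0 : ser_deriv (0 : nat -> C) = 0.
  by apply/funext => n; rewrite ser_derivE scaler0 oppr0.
move: w; apply: polymod_ind => [w w' Ew Ew'|a|w Ew].
- by rewrite linearD cls_Y_D1 Ew Ew' addr0.
- move: g; apply: polymod_ind => [g g' Eg Eg'|v|g Eg].
  + by rewrite cls_Y_D2 Eg Eg' addr0.
  + rewrite dhat_mono -shift_mono; apply/funext => n.
    rewrite (linear_predB (cls_Y_lin1 _ n)) cls_Y_shift1 ser_derivE !cls_Y_gen opprK.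
    case: n => [|[|n]] /=.
    * by rewrite scale0r addr0 (tc_d0 tc) linear0.
    * by rewrite scale1r (tc_d1 tc) linearN addNr.
    * rewrite linear0 add0r.
      by case: n => [|n]; rewrite ?(op1_in0l tc) linear0 scaler0.
  + rewrite cls_Y_shift2 Eg; apply/funext => n.
    by rewrite /ser_cov ser_deriv0 linear0 subr0.
- by rewrite dhat_shift cls_Y_shift1 Ew ser_deriv0.
Qed.

(** Independence of the second representative follows from that of the first, since [cls_Y] is
    already known to be skew symmetric. *)
Lemma conf_YE f g : conf_Y d op (cls f) (cls g) = cls_Y f g.
Proof.
apply/funext => n; rewrite /conf_Y -/(cls _) -/(cls_Y _ _ n).
have /clsP[w wE] := cls_repr (cls f); have /clsP[z zE] := cls_repr (cls g).
have -> : repr (cls f) = f + dhat d w by rewrite wE addrC subrK.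
have -> : repr (cls g) = g + dhat d z by rewrite zE addrC subrK.
rewrite cls_Y_D1 cls_Y_dhat1 addr0 cls_Y_D2 [cls_Y f (dhat d z)]cls_Y_skew.
rewrite cls_Y_dhat1 serE [ser_skew _ _ _](_ : _ = 0) ?addr0 //.
by rewrite (@ser_skewE _ _ _ 0) ?big_ord0.
Qed.

End ConformalAlgebra.

Lemma zmod_rearrange (V : zmodType) (a b c p p' q q' r : V) :
  p + q - (b + a) + a + (p' + q' - c) =
  p + p' + (q + q' + (a + r)) - (b + c + (a + r)).
Proof.
have -> : p + q - (b + a) + a = p + q - b by rewrite opprD addrA subrK.
have -> : p + p' + (q + q' + (a + r)) - (b + c + (a + r)) =
    p + p' + (q + q') - (b + c) by rewrite addrA [b + c + _]addrC addrKA.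
by rewrite [X in _ = X - _]addrACA opprD -[RHS]addrACA.
Qed.

(** * The vertex Lie algebra of a 1-truncated conformal algebra *)

Section ConformalVertexLie.
Variables (K : fieldType) (A B : lmodType K).
Variables (d : {linear A -> B}) (op : 'I_2 -> A * B -> A * B -> A * B).
Hypothesis char0 : forall n, n.+1%:R != 0 :> K.
Hypothesis tc : truncated_conformal d op.
Local Notation AB := (A * B)%type.
Local Notation CAB := (polymod AB).
Local Notation C := (conf_alg d).
Local Notation D := (@conf_der K A B d).
Local Notation Y := (conf_Y d op).

Lemma conf_Y_linl y n : linear (fun x => Y x y n).
Proof.
move=> c x x'; rewrite -[x]cls_repr -[x']cls_repr -[y]cls_repr -cls_is_linear.
by rewrite !conf_YE // cls_Y_lin1.
Qed.

Lemma conf_Y_linr x n : linear (fun y => Y x y n).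
Proof.
move=> c y y'; rewrite -[x]cls_repr -[y']cls_repr -[y]cls_repr -cls_is_linear.
by rewrite !conf_YE // cls_Y_lin2.
Qed.

Lemma finite_seq_conf_Y x y : finite_seq (Y x y).
Proof.
by rewrite -[x]cls_repr -[y]cls_repr conf_YE //; exact: finite_seq_cls_Y.
Qed.

Lemma conf_Y_deriv x y : Y (conf_der x) y = ser_deriv (Y x y).
Proof. by rewrite -[x]cls_repr -[y]cls_repr conf_derE !conf_YE // cls_Y_shift1. Qed.

Lemma conf_Y_skew x y : Y x y = ser_skew D (Y y x).
Proof. by rewrite -[x]cls_repr -[y]cls_repr !conf_YE // -cls_Y_skew. Qed.

Lemma conf_Y_gen u v n : Y (gen d u) (gen d v) n = gen d (opn op n u v).
Proof. by rewrite conf_YE // cls_Y_gen. Qed.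

(** The axiom [tc_jacobi] is the case m = 0, n <= 1, and m = 1, n = 0 follows from it. In all other
    cases both sides vanish, because products of index 2 or more are zero and u_1 v lies in A. *)
Lemma conf_jacobi_gen a b c : jacobi Y (gen d a) (gen d b) (gen d c).
Proof.
move=> m n.
have -> : (fun i => Y (Y (gen d a) (gen d b) i) (gen d c)) =
    fun i k => gen d (opn op k (opn op i a b) c).
  by apply/funext => i; apply/funext => k; rewrite !conf_Y_gen.
rewrite !conf_Y_gen.
have opn1 k x y z : opn op k.+1 (op ord_max x y) z = 0.
  by case: k => //=; rewrite (op1_in0 tc x) (op1_in0l tc).
case: m => [|[|m]].
- case: n => [|[|n]] /=; rewrite -linearB; congr (gen d _).
  + by rewrite (tc_jacobi tc) addrC addKr.
  + by rewrite (tc_jacobi tc) addrC addKr.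
  + by rewrite (linear_pred0 (tc_linr tc _ _)) subr0.
- rewrite [RHS]/= serD serZ scale1r /ser_shift -linearB -linearD.
  congr (gen d _); case: n => [|[|n]] /=.
  (* The axiom is applied to b_0 (a_1 c). It remains that (a_0 b)_1 + (b_0 a)_1 = (d (b_1 a))_1 = -
     (b_1 a)_0, which cancels (a_1 b)_0. *)
  + have := tc_jacobi tc ord_max b a c => ->.
    rewrite opprD addNKr (op0_skew tc a b) (linear_predD (tc_linl tc _ c)).
    rewrite (linear_predN (tc_linl tc _ c)) (tc_d1 tc) -(op1_in0 tc).
    by rewrite (op1_sym tc b a) -addrA addNr addr0.
  + rewrite (op1_in0 tc b c) (op1_in0 tc a c) !(op1_in0r tc).
    by rewrite (op1_in0 tc a b) (op1_in0l tc) subr0 addr0.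
  + by rewrite (linear_pred0 (tc_linr tc _ _)) subr0 addr0.
- rewrite binom_ser1E /= (opn0r tc) subrr big1 // => i _.
  case: i => -[|[|i]] ltim /=.
  + by rewrite linear0 scaler0.
  + by rewrite [X in gen d X](opn1 (m + n)%N) linear0 scaler0.
  + by rewrite (opn0l tc) linear0 scaler0.
Qed.

Lemma conf_jacobi a b c : jacobi Y a b c.
Proof.
refine (@jacobi_generated K C D Y char0 conf_Y_linl conf_Y_linr finite_seq_conf_Y
  conf_Y_deriv conf_Y_skew (range (gen d)) _ _ a b c).
  move=> {}a {}b J {}c; rewrite -[c]cls_repr.
  elim/polymod_ind: (repr c) => [f g Jf Jg|u|f Jf].
  - rewrite (linear_predD (@cls_is_linear _ _ _ d)).
    exact: (jacobi_add conf_Y_linr).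
  - by apply: J; exists u.
  - rewrite -conf_derE.
    exact: (@jacobi_der K C D Y char0 conf_Y_linr finite_seq_conf_Y conf_Y_deriv
      conf_Y_skew a b _ Jf).
by move=> _ _ _ [u _ <-] [v _ <-] [w _ <-]; exact: conf_jacobi_gen.
Qed.

Lemma conf_vertex_lie : vertex_lie D Y.
Proof.
split.
- exact: conf_der_is_linear.
- exact: conf_Y_linl.
- exact: conf_Y_linr.
- exact: finite_seq_conf_Y.
- exact: conf_Y_deriv.
- exact: conf_Y_skew.
- by move=> a b c m n; rewrite conf_jacobi binom_ser1E.
Qed.

Definition euler_val (f : CAB) : nat -> AB :=
  fun n => (n%:R *: (f n).1, n.+1%:R *: (f n).2).

Lemma euler_fin f : euler_val f \in @fin_seq K AB.
Proof.
have [N fN] := polymod_finite f; apply/asboolP; exists N => n Nn.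
by rewrite /euler_val fN //= !scaler0.
Qed.

Definition poly_euler f : CAB := PolyMod (euler_fin f).

Lemma poly_euler_is_linear : linear poly_euler.
Proof.
move=> c f g; apply: polymodP => n; rewrite polymodD polymodZ.
congr pair; rewrite /= scalerDr !scalerA; congr (_ *: _ + _); exact: mulrC.
Qed.
HB.instance Definition _ :=
  GRing.isLinear.Build K CAB CAB _ poly_euler poly_euler_is_linear.

Lemma poly_euler_shift f : poly_euler (shift f) = shift (poly_euler f) + shift f.
Proof.
apply: polymodP => n; rewrite polymodD; congr pair; case: n => [|n];
  by rewrite /= ?scale0r ?scaler0 ?addr0 // -natr1 scalerDl scale1r.
Qed.

Lemma poly_euler_mono0 u : poly_euler (mono 0 u) = mono 0 (in1 u.2).
Proof.
apply: polymodP => -[|n]; congr pair; rewrite /= /mono_val /= ?scale0r ?scale1r //.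
  by rewrite scaler0.
by rewrite scaler0.
Qed.

(** As [dhat] has degree 1, the witness is w plus the degree operator of C(A) applied to w. *)
Lemma poly_euler_dhat w : exists w', poly_euler (dhat d w) = dhat d w'.
Proof.
have dD x y : dhat d (x + y) = dhat d x + dhat d y by exact: linearD.
have eD x y : poly_euler (x + y) = poly_euler x + poly_euler y by exact: linearD.
move: w; apply: polymod_ind => [f g [f' Ef] [g' Eg]|a|f [f' Ef]].
- by exists (f' + g'); rewrite !dD eD Ef Eg.
- exists (mono 0 a); rewrite dhat_mono -shift_mono.
  rewrite (linear_predB poly_euler_is_linear) poly_euler_shift !poly_euler_mono0 /=.
  by rewrite !linear0 add0r.
- exists (shift f' + shift f).
  by rewrite dD !dhat_shift poly_euler_shift Ef.
Qed.

Definition conf_euler (x : C) : C := cls d (poly_euler (repr x)).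

Lemma conf_eulerE f : conf_euler (cls d f) = cls d (poly_euler f).
Proof.
have /clsP[w wE] := cls_repr (cls d f); have [w' w'E] := poly_euler_dhat w.
by apply/clsP; exists w'; rewrite -w'E wE linearB.
Qed.

Lemma conf_euler_is_linear : linear conf_euler.
Proof.
move=> c x y; rewrite -[x]cls_repr -[y]cls_repr -cls_is_linear !conf_eulerE.
by rewrite poly_euler_is_linear cls_is_linear.
Qed.
HB.instance Definition _ :=
  GRing.isLinear.Build K C C _ conf_euler conf_euler_is_linear.

Lemma conf_euler_der x : conf_euler (conf_der x) = conf_der (conf_euler x) + conf_der x.
Proof.
rewrite -[x]cls_repr conf_derE !conf_eulerE conf_derE.
by rewrite poly_euler_shift linearD.
Qed.

Lemma conf_euler_Y x y n : conf_euler (Y x y n) =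
  Y (conf_euler x) y n + Y x (conf_euler y) n - n.+1%:R *: Y x y n.
Proof.
have eD f g : poly_euler (f + g) = poly_euler f + poly_euler g by exact: linearD.
have cD z t : conf_euler (z + t) = conf_euler z + conf_euler t by exact: linearD.
have cN z : conf_euler (- z) = - conf_euler z by exact: linearN.
have cZ k z : conf_euler (k *: z) = k *: conf_euler z by exact: linearZ.
have DD z t : D (z + t) = D z + D t by exact: linearD.
have DN z : D (- z) = - D z by exact: linearN.
have DZ k z : D (k *: z) = k *: D z by exact: linearZ.
rewrite -[x]cls_repr -[y]cls_repr (conf_eulerE (repr x)) (conf_eulerE (repr y)).
rewrite !(conf_YE char0 tc).
move: (repr x) (repr y) n; apply: (cls_Y_ind (P := fun f g => forall n, _ = _))
  => [f f' g Ef Ef' n|f g g' Eg Eg' n|u v n|f g Ef n|f g Eg n].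
- rewrite eD !(cls_Y_D1 char0 tc) !serD cD Ef Ef' scalerDr opprD.
  by rewrite addrACA [X in X + _ = _]addrACA.
- rewrite eD !(cls_Y_D2 char0 tc) !serD cD Eg Eg' scalerDr opprD.
  by rewrite addrACA [X in X + _ = _]addrACA.
- rewrite !poly_euler_mono0 !(cls_Y_gen char0 tc) conf_eulerE poly_euler_mono0.
  have gl := @gen_is_linear _ _ _ d; rewrite -/(gen d _) (opn_euler tc).
  by rewrite (linear_predB gl) (linear_predD gl) (linear_predZ gl).
- rewrite poly_euler_shift (cls_Y_D1 char0 tc) !(cls_Y_shift1 char0 tc) serD.
  rewrite !ser_derivE cN cZ Ef; move: (cls_Y _ _ _ _ _) => F.
  move: (cls_Y _ _ _ _ _) (cls_Y _ _ _ _ _) => G H.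
  case: n => [|n] /=; first by rewrite !scale0r !oppr0 scaler0 oppr0 !addr0.
  rewrite -[n.+2%:R]natr1 scalerDl scale1r !scalerN opprD !opprK.
  rewrite scalerBr scalerDr opprB.
  by rewrite [X in _ = X + _]addrAC [RHS]addrC addrACA subrr addr0 -opprD.
- rewrite poly_euler_shift (cls_Y_D2 char0 tc) !(cls_Y_shift2 char0 tc) serD.
  rewrite /ser_cov !ser_derivE !opprK cD cZ conf_euler_der !Eg.
  rewrite -[n.+1%:R]natr1 !(scalerDl, scale1r).
  (* [n.-1.+1] differs from n at n = 0, where the outer factor n vanishes. *)
  have -> z : n%:R *: (z - n.-1.+1%:R *: cls_Y d op f g n.-1) =
      n%:R *: z - n%:R *: (n%:R *: cls_Y d op f g n.-1).
    by rewrite scalerBr; case: (n) => //; rewrite !scale0r.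
  rewrite DD DN !DD DZ !scalerDr /=.
  set F := conf_der (cls_Y _ _ f g n); set F' := cls_Y _ _ f g n.-1.
  set G := conf_der _; set G' := _ *: cls_Y _ _ _ g _; set H := conf_der _.
  set H' := _ *: cls_Y _ _ f _ _; exact: zmod_rearrange.
Qed.

End ConformalVertexLie.

(** * The grading *)

Section ConformalGrading.
Variables (K : fieldType) (A B : lmodType K) (d : {linear A -> B}).
Local Notation AB := (A * B)%type.
Local Notation CAB := (polymod AB).
Local Notation C := (conf_alg d).
Local Notation SC := (symalg C).

Lemma conf_grading_mono0 n a : conf_grading d n (conf_mono d n (in0 a)).
Proof.
exists (mono n (in0 a)) => // m; rewrite /= /mono_val.
by split; case: (m == n).
Qed.

Lemma conf_grading_mono1 n b : conf_grading d n.+1 (conf_mono d n (in1 b)).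
Proof.
exists (mono n (in1 b)) => // m; rewrite /= /mono_val eqSS.
by split; case: (m == n).
Qed.

Lemma conf_grading_euler n (x : C) : conf_grading d n x -> conf_euler x = n%:R *: x.
Proof.
move=> [f fn <-]; rewrite -/(cls d f) conf_eulerE.
rewrite -(linear_predZ (@cls_is_linear _ _ _ d)).
congr (cls d _); apply: polymodP => m; rewrite polymodZ.
have [f1 f2] := fn m; congr pair => /=.
  by case: (eqVneq m n) f1 => [->//|_ /(_ isT) ->]; rewrite !scaler0.
by case: (eqVneq m.+1 n) f2 => [->//|_ /(_ isT) ->]; rewrite !scaler0.
Qed.

Lemma conf_grading_span (x : C) : exists2 s : seq (nat * C),
  {in s, forall p, conf_grading d p.1 p.2} & x = \sum_(p <- s) p.2.
Proof.
rewrite -[x]cls_repr; elim/polymod_mono_ind: (repr x) => [f g [s sP Es] [t tP Et]|n u].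
  exists (s ++ t); first by move=> p; rewrite mem_cat => /orP[/sP|/tP].
  by rewrite (linear_predD (@cls_is_linear _ _ _ d)) big_cat Es Et.
exists [:: (n, conf_mono d n (in0 u.1)); (n.+1, conf_mono d n (in1 u.2))].
  move=> p; rewrite !inE => /orP[/eqP->|/eqP->].
    exact: conf_grading_mono0.
  exact: conf_grading_mono1.
rewrite big_cons big_seq1 /= {1}[u]in01_split (linear_predD (@mono_is_linear _ _ n)).
exact: (linear_predD (@cls_is_linear _ _ _ d)).
Qed.

Lemma conf_grading0 (x : C) : conf_grading d 0 x -> exists a, x = conf_mono d 0 (in0 a).
Proof.
move=> [f fn <-]; exists (f 0%N).1; congr (qproj _ _); apply: polymodP => m.
rewrite /= /mono_val [LHS]in01_split; have [f1 ->] // := fn m.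
rewrite linear0 addr0; case: eqP f1 => [->//|_ /(_ isT) ->].
exact: linear0.
Qed.

(* In degree [n + 1], [D^(n+1) a] equals [D^n (d a)]. *)
Lemma conf_gradingS n (x : C) :
  conf_grading d n.+1 x -> exists b, x = conf_mono d n (in1 b).
Proof.
move=> [f fn <-]; exists (d (f n.+1).1 + (f n).2).
have fE : f = mono n.+1 (in0 (f n.+1).1) + mono n (in1 (f n).2) :> CAB.
  apply: polymodP => m; rewrite polymodD /= /mono_val [LHS]in01_split.
  have [f1 f2] := fn m; congr (_ + _).
    by case: eqP f1 => [->//|_ /(_ isT) ->]; exact: linear0.
  rewrite eqSS in f2.
  by case: eqP f2 => [->//|_ /(_ isT) ->]; exact: linear0.
move: (f n.+1).1 (f n).2 fE => a b ->; apply/clsP; exists (- mono n a).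
rewrite (linear_predN (@dhat_is_linear _ _ _ d)) dhat_mono opprB.
rewrite (linear_predD (@in1_is_linear _ A B)) (linear_predD (@mono_is_linear _ _ n)).
by rewrite [in RHS](addrC (mono n _)) addrKA.
Qed.

(** Elements of the image of [dhat] have no A-component at D^0, so this does not depend on the
    representative. It is a retraction of A -> C. *)
Definition conf_fst (x : C) : A := (repr x 0%N).1.

Lemma conf_fstE f : conf_fst (cls d f) = (f 0%N).1.
Proof.
rewrite /conf_fst; have /clsP[w wE] := cls_repr (cls d f).
have -> : repr (cls d f) = f + dhat d w by rewrite wE addrC subrK.
by rewrite polymodD dhatE subr0 /= addr0.
Qed.

Lemma conf_fst_is_linear : linear conf_fst.
Proof.
move=> c x y; rewrite -[x]cls_repr -[y]cls_repr -cls_is_linear !conf_fstE.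
by rewrite polymodD polymodZ.
Qed.
HB.instance Definition _ :=
  GRing.isLinear.Build K C A _ conf_fst conf_fst_is_linear.

Lemma symalg_degree0 :
  exists g : {lrmorphism symalg A -> SC},
    [/\ forall a, g (symin a) = symin (conf_mono d 0 (in0 a)),
        injective g & range g = sconf_grading d 0%N].
Proof.
pose h0 : {linear A -> SC} := @symin K C \o (@gen K A B d \o @in0 K A B).
pose k0 : {linear C -> symalg A} := @symin K A \o conf_fst.
have gE a : symlift h0 (symin a) = symin (conf_mono d 0 (in0 a)).
  by rewrite symlift_symin.
exists (symlift h0); split=> //.
  (* The retraction [conf_fst] induces an algebra map S(C) -> S(A), a left inverse. *)
  apply: (can_inj (g := symlift k0)); apply: symalg_ind => [a|c|x y Ex Ey|x y Ex Ey].
  - by rewrite /= gE symlift_symin /= -/(gen d _) /gen conf_fstE.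
  - by rewrite /= !symlift_cst.
  - by rewrite /= !symlift_add Ex Ey.
  - by rewrite /= !symlift_mul Ex Ey.
apply/seteqP; split=> [_ [x _ <-]|].
  move: x; apply: symalg_ind => [a|c|x y Gx Gy|x y Gx Gy] /=.
  - rewrite gE; apply: sub_lin_span; exists [:: (0%N, conf_mono d 0 (in0 a))].
    rewrite !big_seq1; split=> // p; rewrite inE => /eqP->.
    exact: conf_grading_mono0.
  - rewrite symlift_cst; exists [:: (c, 1)]; last by rewrite big_seq1.
    by move=> p; rewrite inE => /eqP->; exists [::]; rewrite !big_nil.
  - by rewrite symlift_add -[symlift h0 x]scale1r; exact: lin_span_lin.
  - by rewrite symlift_mul; exact: (sym_grading_mul (m := 0) (n := 0)).
apply: lin_span_ind => [|c _ _ [x _ <-] [y _ <-]|_ [s [sP s0 ->]]].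
- by exists 0 => //; rewrite linear0.
- by exists (c *: x + y) => //; rewrite linearP.
- elim: s sP s0 => [|p s IH] sP; first by exists 1 => //; rewrite big_nil rmorph1.
  (* Degrees are natural numbers: in a product of degree 0 every factor has degree 0, hence comes
     from A. *)
  rewrite !big_cons => /eqP; rewrite addn_eq0 => /andP[/eqP p0 /eqP s0].
  have [|x _ xE] := IH _ s0; first by move=> q qs; apply: sP; rewrite inE qs orbT.
  have := sP _ (mem_head _ _); rewrite p0 => /conf_grading0[a ->].
  by exists (symin a * x) => //; rewrite rmorphM /= gE -xE.
Qed.

(** A homogeneous generator is an element of A in degree 0 and some D^k b in degree k + 1; the
    summand [size bs] collects these extra ones. *)
Lemma sconf_grading_span n : (1 <= n)%N ->
  sconf_grading d n =
  lin_span [set x | exists (bs : seq (nat * B)) (l : seq A),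
    [/\ (1 <= size bs)%N, sorted geq [seq p.1 | p <- bs],
        (\sum_(p <- bs) p.1 + size bs)%N = n &
        x = (\prod_(p <- bs) symin (conf_mono d p.1 (in1 p.2))) *
            \prod_(a <- l) symin (conf_mono d 0 (in0 a))]].
Proof.
move=> n1; apply/seteqP; split; apply: lin_span_ind;
  do ?[exact: lin_span0 | by move=> c u v; exact: lin_span_lin].
- move=> _ [s [sP sn ->]]; apply: sub_lin_span.
  have [bs [l [sE ->]]] : exists (bs : seq (nat * B)) (l : seq A),
      (\sum_(p <- s) p.1 = \sum_(p <- bs) p.1 + size bs)%N /\
      \prod_(p <- s) symin p.2 =
      (\prod_(p <- bs) symin (conf_mono d p.1 (in1 p.2))) *
      \prod_(a <- l) symin (conf_mono d 0 (in0 a)) :> SC.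
    elim: s sP {sn} => [|[k x] s IH] sP.
      by exists [::], [::]; rewrite !big_nil mulr1.
    have [|bs [l [sE pE]]] := IH; first by move=> q qs; apply: sP; rewrite inE qs orbT.
    have := sP _ (mem_head _ _) => /=; rewrite !big_cons /= sE pE.
    case: k {sP} => [/conf_grading0[a ->]|k /conf_gradingS[b ->]].
      by exists bs, (a :: l); rewrite big_cons mulrCA.
    exists ((k, b) :: bs), l; rewrite !big_cons /= mulrA; split=> //.
    by rewrite addnS addSn addnA.
  (* The factors commute, so they may be sorted by decreasing power of D. *)
  pose r (p q : nat * B) := (q.1 <= p.1)%N.
  have pbs : perm_eq (sort r bs) bs by rewrite perm_sort.
  exists (sort r bs), l; rewrite size_sort !(perm_big _ pbs) /= -sE; split=> //.
  (* Elements of A contribute no degree, so n >= 1 forces a factor from B. *)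
  + move: n1; rewrite -sn sE; case: bs {sE pbs} => //=.
    by rewrite big_nil.
  + rewrite sorted_map; apply: sort_sorted => p q; exact: leq_total.
- move=> _ [bs [l [_ _ <- ->]]]; apply: sub_lin_span.
  exists ([seq (p.1.+1, conf_mono d p.1 (in1 p.2)) | p <- bs] ++
          [seq (0%N, conf_mono d 0 (in0 a)) | a <- l]).
  rewrite !big_cat !big_map /=; split=> //.
    move=> p; rewrite mem_cat => /orP[/mapP[q _ ->]|/mapP[a _ ->]].
      exact: conf_grading_mono1.
    exact: conf_grading_mono0.
  rewrite big1_eq addn0; under eq_bigr do rewrite -addn1.
  by rewrite big_split /= sum1_size.
Qed.

End ConformalGrading.

Theorem theorem4p15 (R : realType) (A B : lmodType R[i]) (d : {linear A -> B})
    (op : 'I_2 -> A * B -> A * B -> A * B) :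
  truncated_conformal d op ->
  [/\ graded_vertex_poisson (sconf_der d) (sconf_Y d op) (sconf_grading d),
      exists g : {lrmorphism symalg A -> symalg (conf_alg d)},
        [/\ forall a, g (symin a) = symin (conf_mono d 0 (in0 a)),
            injective g & range g = sconf_grading d 0%N] &
      forall n, (1 <= n)%N ->
        sconf_grading d n =
        lin_span [set x | exists (bs : seq (nat * B)) (l : seq A),
          [/\ (1 <= size bs)%N, sorted geq [seq p.1 | p <- bs],
              (\sum_(p <- bs) p.1 + size bs)%N = n &
              x = (\prod_(p <- bs) symin (conf_mono d p.1 (in1 p.2))) *
                  \prod_(a <- l) symin (conf_mono d 0 (in0 a))]]].
Proof.
move=> tc.
have char0 n : n.+1%:R != 0 :> R[i] by rewrite Num.Theory.pnatr_eq0.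
split; [|exact: symalg_degree0|exact: sconf_grading_span].
(* The degree operator of C is supplied by hand, as the goal does not mention it. *)
apply: (sym_graded_vertex_poisson (eC := @conf_euler _ _ _ d) char0).
- exact: conf_grading_euler.
- exact: conf_grading_span.
- exact: conf_vertex_lie.
- exact: conf_euler_der.
- by move=> u v m; apply: conf_euler_Y.
Qed.
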